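(* In the Bayesian $k$-armed bandit problem described in the context, suppose the prior $\Gamma$ is $1$-regular with constants $0<c_0<C_0$ (i.e. $c_0\epsilon\le\mathbb{P}_\Gamma(\mu>1-\epsilon)\le\mathbb{P}_\Gamma(\mu\ge1-\epsilon)\le C_0\epsilon$ for all $\epsilon\in(0,1]$) and every $P_\mu$ is $1$-subgaussian. Then the subsampled UCB algorithm run with $m=\lceil\sqrt T\rceil$ satisfies $$BR_{T,k}(\text{SS-UCB})\le 2+\sqrt T\Bigl[\frac{\log T}{c_0}+\frac{C_0\log^2T}{c_0^2}+C_0(20+36\log f(T))\bigl(5+\log(\sqrt T c_0)-\log\log T\bigr)\Bigr].$$
   Context: Bayesian $k$-armed bandit: horizon $T$, arms $[k]$, family $\{P_\mu:\mu\in[0,1]\}$ with $P_\mu$ of mean $\mu$; prior $\Gamma$ on $[0,1]$ with density; means i.i.d. $\sim\Gamma$; pulling arm $i$ at time $t$ gives $Y_{it}\sim P_{\mu_i}$ independently, only the pulled reward observed. $R_T(\pi\mid\bm\mu)=T\max_i\mu_i-\sum_{t}\mathbb{E}[\mu_{a_t}\mid\pi]$, $BR_{T,k}(\pi)=\mathbb{E}[R_T(\pi\mid\bm\mu)]$. $1$-subgaussian: $\mathbb{E}[e^{s(Z-\mu)}]\le e^{s^2/2}$ for $Z\sim P_\mu$, all real $s$. $N_i(t)$ = number of pulls of arm $i$ up to $t$, $\hat\mu_i(t)$ = empirical mean of its rewards (equal to $1$ if $N_i(t)=0$), $f(t)=1+t\log^2 t$. UCB on an arm set: pull each arm once, then pull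 $\arg\max_i[\hat\mu_i(t-1)+\sqrt{2\log f(t)/N_i(t-1)}]$. SS-UCB with parameter $m$: draw $m$ arms uniformly at random without replacement from $[k]$ and run UCB on them only. *)

(* Defs.v *)
From HB Require Import structures.
From mathcomp Require Import all_boot all_order all_algebra.
From mathcomp Require Import all_classical all_reals all_analysis.
From mathcomp Require Import measurable_realfun.
Set Implicit Arguments. Unset Strict Implicit. Unset Printing Implicit Defensive.
Import Order.TTheory GRing.Theory Num.Theory.
Import numFieldNormedType.Exports.
Local Open Scope classical_set_scope.
Local Open Scope ring_scope.

Section Bandit.
Variable R : realType.

Definition flog (t : nat) : R := 1 + t%:R * (ln (t%:R : R)) ^+ 2.

(* Iterated integral: integrate coordinate c of the "sample" Y against Q c,
   successively for c in cs (= expectation w.r.t. the product measure of the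
   Q c, c in cs, the remaining coordinates being those of Y). *)
Definition upd (I : eqType) (Y : I -> R) (c : I) (y : R) : I -> R :=
  fun j => if j == c then y else Y j.

Fixpoint iint (I : eqType) (Q : I -> probability R R) (cs : seq I)
  (F : (I -> R) -> \bar R) (Y : I -> R) : \bar R :=
  match cs with
  | [::] => F Y
  | c :: cs' => (\int[Q c]_y iint Q cs' F (upd Y c y))%E
  end.

Variable k : nat.

(* h = sequence of arms pulled at times 1, 2, ..., size h;
   Y (i, t) = reward that arm i yields if pulled at time t. *)
Definition npulls (h : seq 'I_k) (i : 'I_k) : nat := count (pred1 i) h.

Definition rsum (Y : 'I_k * nat -> R) (h : seq 'I_k) (i : 'I_k) : R :=
  \sum_(s < size h | nth i h s == i) Y (i, s.+1).

Definition empmean (Y : 'I_k * nat -> R) (h : seq 'I_k) (i : 'I_k) : R :=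
  if npulls h i == 0%N then 1 else rsum Y h i / (npulls h i)%:R.

Definition ucb_index (Y : 'I_k * nat -> R) (h : seq 'I_k) (i : 'I_k) : R :=
  empmean Y h i
  + Num.sqrt (2 * ln (flog (size h).+1) / (npulls h i)%:R).

Definition ucb_next (S : {set 'I_k}) (Y : 'I_k * nat -> R) (h : seq 'I_k)
  : option 'I_k :=
  if [pick i in S | npulls h i == 0%N] is Some i then Some i
  else [pick i in S | [forall j in S, ucb_index Y h j <= ucb_index Y h i]].

Fixpoint ucb_hist (S : {set 'I_k}) (Y : 'I_k * nat -> R) (t : nat)
  : seq 'I_k :=
  match t with
  | 0 => [::]
  | t'.+1 => let h := ucb_hist S Y t' in
             if ucb_next S Y h is Some i then rcons h i else h
  end.

Definition mean_pulled (mu : 'I_k -> R) (S : {set 'I_k})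
  (Y : 'I_k * nat -> R) (T t : nat) : R :=
  oapp mu 0 (onth (ucb_hist S Y T) t.-1).

Definition coords (T : nat) : seq ('I_k * nat) :=
  [seq (i, t) | i <- enum 'I_k, t <- iota 1 T].

(* E[mu_{a_t} | SS-UCB(m), mu]: average over the uniformly random m-subset S,
   expectation over the independent rewards Y_(i,t) ~ P_(mu_i). *)
Definition ssucb_exp_mean (P : R -> probability R R) (m T : nat)
  (mu : 'I_k -> R) (t : nat) : \bar R :=
  ((\sum_(S : {set 'I_k} | #|S| == m)
      iint (fun c : 'I_k * nat => P (mu c.1)) (coords T)
        (fun Y => (mean_pulled mu S Y T t)%:E) (fun _ => 0%R))
   * ((#|[set S : {set 'I_k} | #|S| == m]|%:R)^-1)%:E)%E.

Definition ssucb_regret (P : R -> probability R R) (m T : nat)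
  (mu : 'I_k -> R) : \bar R :=
  ((T%:R * \big[Num.max/0]_(i < k) mu i)%:E
   - \sum_(1 <= t < T.+1) ssucb_exp_mean P m T mu t)%E.

Definition ssucb_bayes_regret (Gamma : probability R R)
  (P : R -> probability R R) (m T : nat) : \bar R :=
  iint (fun _ : 'I_k => Gamma) (enum 'I_k)
    (ssucb_regret P m T) (fun _ => 0%R).

End Bandit.

(* Main.v *)
(** Put [theta = ln T / (c0 sqrt T)].  By regularity all [m >= sqrt T] sampled
    arms have mean below [1 - theta] with probability at most
    [(1 - c0 theta)^m <= 1/T].  On the complement, the arms of mean at least
    [1 - 10 theta] cost at most [10 theta T] together, and any other arm, of
    mean [1 - r], has gap at least [9r/10] to the best sampled one, so the UCB
    analysis bounds its cost by [1 + a/r] with [a] of order [log f(T)].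
    Regularity again, by dyadic peeling, gives
    [E[1/r; r > theta] <= 1 + C0 (1 + (3/2) ln (1/theta))].  The crude constants
    obtained in this way are absorbed once [log f(T) >= 17]; for smaller [T] the
    asserted bound already exceeds [T].

    The bound on the number of pulls of an arm is pointwise in the rewards: it
    is a combination of exponential supermartingales, so that only their
    integrals remain to be estimated.  Such a supermartingale follows the first
    [n] rewards of an arm only, which replaces a stopping time. *)
Require Import Defs.
From HB Require Import structures.
From mathcomp Require Import all_boot all_order all_algebra.
From mathcomp Require Import all_classical all_reals all_analysis.
From mathcomp Require Import measurable_realfun.
From mathcomp Require Import ring lra zify.
Set Implicit Arguments. Unset Strict Implicit. Unset Printing Implicit Defensive.
Import Order.TTheory GRing.Theory Num.Theory.
Import numFieldNormedType.Exports.
Local Open Scope classical_set_scope.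
Local Open Scope ring_scope.

(** * Iterated integrals *)

Section IteratedIntegral.
Variables (R : realType) (I : eqType).
Local Open Scope ereal_scope.

(* Measurability for the product sigma-algebra, tested on measurable families so
   that no measurable structure on [I -> R] is needed. *)
Definition fammeas (F : (I -> R) -> \bar R) : Prop :=
  forall (d : measure_display) (T : measurableType d) (p : T -> I -> R),
    (forall i, measurable_fun setT (p ^~ i)) ->
    measurable_fun setT (fun w => F (p w)).

(** Monotonicity is read off the suprema over simple functions that define the integrals of the
    positive and negative parts, so it also covers integrands not known to be measurable. *)
Lemma le_integral_nomeas (mu : probability R R) (f g : R -> \bar R) :
  (forall x, f x <= g x) -> \int[mu]_x f x <= \int[mu]_x g x.
Proof.
move=> fg; rewrite /integral !patch_setT.
apply: leeB; apply: ereal_sup_le => _ /= [h hf <-];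
  exists h => // x; apply: le_trans (hf x) _.
- by rewrite !funeposE ge_max !le_max lexx orbT andbT fg.
- by rewrite !funenegE ge_max !le_max lexx orbT andbT leeN2 fg.
Qed.

Lemma integral_prob_cst (mu : probability R R) (k : \bar R) : \int[mu]_x k = k.
Proof.
have /= -> := @integral_cst _ _ R mu setT measurableT k.
suff /= -> : mu setT = 1 by rewrite mule1.
exact: probability_setT.
Qed.

Lemma updE (Y : I -> R) c y j : upd Y c y j = if j == c then y else Y j.
Proof. by []. Qed.

Lemma updC (Y : I -> R) c d y z : c != d ->
  upd (upd Y c y) d z = upd (upd Y d z) c y.
Proof.
move=> cd; apply/funext => j; rewrite !updE.
by case: (eqVneq j d) => // ->; rewrite eq_sym (negbTE cd).
Qed.

Lemma upd_upd (Y : I -> R) c y z : upd (upd Y c y) c z = upd Y c z.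
Proof. by apply/funext => j; rewrite !updE; case: eqP. Qed.

Lemma fammeas_upd F c Y : fammeas F -> measurable_fun setT (fun y => F (upd Y c y)).
Proof.
move=> mF; apply: mF => i; rewrite /upd; case: eqP => _.
  exact: measurable_id.
exact: measurable_cst.
Qed.

Lemma measurable_upd d (T : measurableType d) (p : T -> I -> R) c :
  (forall i, measurable_fun setT (p ^~ i)) ->
  forall i, measurable_fun setT (fun w : T * R => upd (p w.1) c w.2 i).
Proof.
move=> mp i; rewrite /upd; case: eqP => _.
  exact: measurable_snd.
exact: (measurableT_comp (mp i) measurable_fst).
Qed.

(** Since [fammeas] quantifies over every parameter space, it can be tested on [T * R], where
    Tonelli's theorem makes the partial integral measurable. *)
Lemma fammeas_integral (Q : probability R R) F c : fammeas F -> (forall Y, 0 <= F Y) ->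
  fammeas (fun Y => \int[Q]_y F (upd Y c y)).
Proof.
move=> mF F0 d T p mp.
have := @measurable_fun_fubini_tonelli_F _ _ T R R Q (fun w => F (upd (p w.1) c w.2)).
apply => //.
by apply: mF; exact: measurable_upd.
Qed.

Variable Q : I -> probability R R.
Notation E cs F := (iint Q cs F).

Lemma iint_ge0 cs F Y : (forall Y, 0 <= F Y) -> 0 <= E cs F Y.
Proof.
by move=> F0; elim: cs Y => //= c cs IH Y; apply: integral_ge0.
Qed.

Lemma fammeas_iint cs F : fammeas F -> (forall Y, 0 <= F Y) -> fammeas (E cs F).
Proof.
move=> mF F0; elim: cs => //= c cs IH.
by apply: fammeas_integral => // Y; exact: iint_ge0.
Qed.

Lemma le_iint cs F G Y : (forall Y, F Y <= G Y) -> E cs F Y <= E cs G Y.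
Proof.
move=> FG; elim: cs Y => //= c cs IH Y.
by apply: le_integral_nomeas => x; exact: IH.
Qed.

Lemma iintD cs F G Y : fammeas F -> fammeas G ->
  (forall Y, 0 <= F Y) -> (forall Y, 0 <= G Y) ->
  E cs (fun Y => F Y + G Y) Y = E cs F Y + E cs G Y.
Proof.
move=> mF mG F0 G0; elim: cs Y => //= c cs IH Y.
under eq_integral do rewrite IH.
by rewrite ge0_integralD//; try (by move=> *; exact: iint_ge0);
  apply: fammeas_upd; exact: fammeas_iint.
Qed.

Lemma iintZ cs F Y k : fammeas F -> (forall Y, 0 <= F Y) -> (0 <= k) ->
  E cs (fun Y => k * F Y) Y = k * E cs F Y.
Proof.
move=> mF F0 k0; elim: cs Y => //= c cs IH Y.
under eq_integral do rewrite IH.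
rewrite ge0_integralZl//; try (by move=> *; exact: iint_ge0).
by apply: fammeas_upd; exact: fammeas_iint.
Qed.

Lemma iint_cst cs k Y : E cs (fun=> k) Y = k.
Proof.
elim: cs Y => //= c cs IH Y; under eq_integral do rewrite IH.
by rewrite integral_prob_cst.
Qed.

Lemma fammeas_cst k : fammeas (fun=> k).
Proof. by move=> *; exact: measurable_cst. Qed.

Lemma fammeas_sum (A : Type) (s : seq A) (F : A -> (I -> R) -> \bar R) :
  (forall a, fammeas (F a)) -> fammeas (fun Y => \sum_(a <- s) F a Y).
Proof. by move=> mF d T p mp; apply: emeasurable_sum => a; exact: mF. Qed.

Lemma fammeasD F G : fammeas F -> fammeas G -> fammeas (fun Y => F Y + G Y).
Proof. by move=> mF mG d T p mp; apply: emeasurable_funD; [exact: mF|exact: mG]. Qed.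

Lemma fammeasZ (k : \bar R) F : fammeas F -> fammeas (fun Y => k * F Y).
Proof.
move=> mF d T p mp; apply: emeasurable_funM; [exact: measurable_cst|exact: mF].
Qed.

Lemma iint_sum cs (A : Type) (s : seq A) (F : A -> (I -> R) -> \bar R) Y :
  (forall a, fammeas (F a)) -> (forall a Y, 0 <= F a Y) ->
  E cs (fun Y => \sum_(a <- s) F a Y) Y = \sum_(a <- s) E cs (F a) Y.
Proof.
move=> mF F0; elim: s => [|a s IH].
  by under eq_fun do rewrite big_nil; rewrite big_nil iint_cst.
under eq_fun do rewrite big_cons.
rewrite iintD ?big_cons ?IH//; first exact: fammeas_sum.
by move=> Z; apply: sume_ge0.
Qed.

(** Tonelli's theorem swaps [c] with the head of [cs]; induction carries it to the innermost
    place. *)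
Lemma iint_rotate c cs F Y : c \notin cs -> fammeas F -> (forall Y, 0 <= F Y) ->
  E (c :: cs) F Y = E cs (fun Z => \int[Q c]_y F (upd Z c y)) Y.
Proof.
move=> + mF F0; elim: cs Y => //= d cs IH Y.
rewrite in_cons negb_or => /andP[cd ccs].
under [RHS]eq_integral do rewrite -IH//.
rewrite /=.
have := @fubini_tonelli _ _ R R R (Q c) (Q d)
  (fun w => E cs F (upd (upd Y c w.1) d w.2)).
rewrite /= => -> //.
- apply: eq_integral => z _; apply: eq_integral => y _.
  by rewrite updC.
- apply: (fammeas_iint cs mF F0 (p := fun w : R * R => upd (upd Y c w.1) d w.2)).
  apply: (measurable_upd (p := fun y => upd Y c y)) => i.
  by rewrite /upd; case: eqP => _; [exact: measurable_id|exact: measurable_cst].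
- by move=> w; exact: iint_ge0.
Qed.

Lemma iint_upd_indep c cs G Y y : (forall Z z, G (upd Z c z) = G Z) ->
  E cs G (upd Y c y) = E cs G Y.
Proof.
move=> Gc; elim: cs Y => //= d cs IH Y; apply: eq_integral => z _.
have [<-|cd] := eqVneq c d; last by rewrite updC ?IH.
by rewrite upd_upd.
Qed.

(* Tonelli: a coordinate may be integrated first, whatever its place in [cs]. *)
Lemma iint_inner c cs F Y : c \in cs -> uniq cs -> fammeas F -> (forall Y, 0 <= F Y) ->
  E cs F Y = E cs (fun Z => \int[Q c]_y F (upd Z c y)) Y.
Proof.
move=> + + mF F0; elim: cs Y => //= d cs IH Y.
rewrite in_cons => /orP[/eqP <-|ccs] /andP[dcs ucs]; last first.
  by apply: eq_integral => y _; rewrite IH.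
rewrite -[LHS]/(E (c :: cs) F Y) iint_rotate//.
(* Once integrated, coordinate [c] no longer matters, so the remaining integral over [c] is that of
   a constant. *)
have Gc (Z : I -> R) z :
    \int[Q c]_y F (upd (upd Z c z) c y) = \int[Q c]_y F (upd Z c y).
  by apply: eq_integral => y _; rewrite upd_upd.
rewrite (eq_integral (fun=> E cs (fun Z => \int[Q c]_y F (upd Z c y)) Y)).
  by rewrite integral_prob_cst.
by move=> z _; rewrite iint_upd_indep.
Qed.

End IteratedIntegral.

(** * Histories of UCB *)

Section History.
Variables (R : realType) (k : nat).
Implicit Types (Y : 'I_k * nat -> R) (h : seq 'I_k) (i j : 'I_k) (S : {set 'I_k}).

Lemma npulls_rcons h j i : npulls (rcons h j) i = (npulls h i + (j == i))%N.
Proof. by rewrite /npulls -cats1 count_cat /= addn0. Qed.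

Lemma rsum_rcons Y h j i :
  rsum Y (rcons h j) i = rsum Y h i + (if j == i then Y (i, (size h).+1) else 0).
Proof.
rewrite /rsum size_rcons big_mkcond big_ord_recr /= nth_rcons ltnn eqxx; congr (_ + _).
rewrite [RHS]big_mkcond; apply: eq_bigr => s _ /=.
by rewrite nth_rcons ltn_ord.
Qed.

(* Centred sum of the first [n] rewards of arm [i] along [h]: frozen after the
   [n]-th pull, it can be evaluated at the horizon. *)
Definition capsum (mu : R) (n : nat) i Y h : R :=
  \sum_(s < size h | (nth i h s == i) && (npulls (take s h) i < n)%N)
    (Y (i, s.+1) - mu).

Lemma capsum_rcons mu n i Y h j : capsum mu n i Y (rcons h j) = capsum mu n i Y h +
  (if (j == i) && (npulls h i < n)%N then Y (i, (size h).+1) - mu else 0).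
Proof.
rewrite /capsum size_rcons big_mkcond big_ord_recr /= nth_rcons ltnn eqxx.
rewrite -cats1 take_size_cat//; congr (_ + _).
rewrite [RHS]big_mkcond; apply: eq_bigr => s _ /=.
by rewrite nth_cat ltn_ord takel_cat // ltnW.
Qed.

Lemma capsumE mu n i Y h : (npulls h i <= n)%N ->
  capsum mu n i Y h = rsum Y h i - mu * (npulls h i)%:R.
Proof.
elim/last_ind: h => [|h j IH]; first by rewrite /capsum /rsum !big_ord0 mulr0 subrr.
rewrite npulls_rcons capsum_rcons rsum_rcons => hn.
rewrite IH; last by apply: leq_trans hn; rewrite leq_addr.
case: (eqVneq j i) hn => /= _; last by rewrite !addn0 !addr0.
by rewrite addn1 => ->; rewrite -natr1; ring.
Qed.

Lemma npulls_cat h h' i : npulls (h ++ h') i = (npulls h i + npulls h' i)%N.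
Proof. by rewrite /npulls count_cat. Qed.

Lemma capsum_cat mu n i Y h h' : (n <= npulls h i)%N ->
  capsum mu n i Y (h ++ h') = capsum mu n i Y h.
Proof.
move=> hn; elim/last_ind: h' => [|h' j IH]; first by rewrite cats0.
rewrite -rcons_cat capsum_rcons IH npulls_cat.
by rewrite ltnNge (leq_trans hn) ?leq_addr// andbF addr0.
Qed.

(** At successive pulls of [i] the number of earlier pulls runs through 0, 1, 2, ... without
    repetition. This turns a sum over rounds into a sum over pull counts. *)
Lemma sum_pulls h i (g : nat -> R) :
  \sum_(s < size h | nth i h s == i) g (npulls (take s h) i) = \sum_(n < npulls h i) g n.
Proof.
elim/last_ind: h => [|h j IH]; first by rewrite !big_ord0.
rewrite size_rcons npulls_rcons big_mkcond big_ord_recr /= nth_rcons ltnn eqxx.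
rewrite -cats1 take_size_cat//.
have -> : \sum_(s < size h) (if nth i (h ++ [:: j]) s == i then
    g (npulls (take s (h ++ [:: j])) i) else 0) = \sum_(n < npulls h i) g n.
  rewrite -IH [RHS]big_mkcond; apply: eq_bigr => s _ /=.
  by rewrite nth_cat ltn_ord takel_cat // ltnW.
by case: eqP => _; rewrite ?addn1 ?addn0 ?big_ord_recr ?addr0.
Qed.

Section Run.
Variables (S : {set 'I_k}) (S0 : (0 < #|S|)%N).

(** As [S] is nonempty, some index is maximal, so [None] never occurs and every round adds a pull.
    Indices are compared only once all arms of [S] have been pulled, hence the disjunction. *)
Lemma ucb_nextP Y h : exists2 i, ucb_next S Y h = Some i & i \in S /\
  (npulls h i = 0%N \/ forall j, j \in S -> (0 < npulls h j)%N /\ ucb_index Y h j <= ucb_index Y h i).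
Proof.
rewrite /ucb_next; case: pickP => [i /andP[iS /eqP hi]|h0].
  by exists i => //; split=> //; left.
have hpos j : j \in S -> (0 < npulls h j)%N.
  by move=> jS; have := h0 j; rewrite jS /= lt0n => ->.
case: pickP => [i /andP[iS /forall_inP hi]|hN].
  by exists i => //; split=> //; right=> j jS; split; [exact: hpos|exact: hi].
have /card_gt0P [i0 i0S] := S0.
have [i iS /= imax] := @arg_maxP _ _ _ i0 (mem S) (ucb_index Y h) i0S.
have := hN i; rewrite (iS : i \in S) /= => /negP[].
by apply/forall_inP => j jS; exact: imax.
Qed.

Lemma size_ucb_hist Y t : size (ucb_hist S Y t) = t.
Proof.
elim: t => //= t IH; have [i -> _] := ucb_nextP Y (ucb_hist S Y t).
by rewrite size_rcons IH.
Qed.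

Lemma ucb_hist_sub Y t i : i \in ucb_hist S Y t -> i \in S.
Proof.
elim: t => //= t IH; have [j -> [jS _]] := ucb_nextP Y (ucb_hist S Y t).
by rewrite mem_rcons in_cons => /orP[/eqP->//|/IH].
Qed.

Lemma ucb_hist_take Y t T : (t <= T)%N -> take t (ucb_hist S Y T) = ucb_hist S Y t.
Proof.
elim: T => [|T IH]; first by rewrite leqn0 => /eqP->.
rewrite leq_eqVlt => /orP[/eqP ->|tT].
  by rewrite take_oversize// size_ucb_hist.
rewrite /=; have [j -> _] := ucb_nextP Y (ucb_hist S Y T).
by rewrite -cats1 takel_cat ?IH// size_ucb_hist.
Qed.

Lemma nth_ucb_hist Y t T i : (t < T)%N ->
  ucb_next S Y (ucb_hist S Y t) = Some (nth i (ucb_hist S Y T) t).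
Proof.
move=> tT; have := ucb_hist_take Y tT; rewrite (take_nth i) ?size_ucb_hist//.
rewrite (ucb_hist_take Y (ltnW tT)) /=.
have [j -> _] := ucb_nextP Y (ucb_hist S Y t).
by move=> /rcons_inj [->].
Qed.

Lemma eq_rsum Y Y' h i : (forall s, (1 <= s <= size h)%N -> Y (i, s) = Y' (i, s)) ->
  rsum Y h i = rsum Y' h i.
Proof. by move=> YY; apply: eq_bigr => s _; rewrite YY//= ltn_ord. Qed.

Lemma eq_capsum mu n Y Y' h i : (forall s, (1 <= s <= size h)%N -> Y (i, s) = Y' (i, s)) ->
  capsum mu n i Y h = capsum mu n i Y' h.
Proof. by move=> YY; apply: eq_bigr => s _; rewrite YY//= ltn_ord. Qed.

Lemma eq_ucb_next Y Y' h :
  (forall i s, (1 <= s <= size h)%N -> Y (i, s) = Y' (i, s)) ->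
  ucb_next S Y h = ucb_next S Y' h.
Proof.
move=> YY; have E i : ucb_index Y h i = ucb_index Y' h i.
  by rewrite /ucb_index /empmean (@eq_rsum Y Y')// => s; exact: YY.
rewrite /ucb_next; case: pickP => // _.
by apply: eq_pick => i /=; congr (_ && _); apply: eq_forallb_in => j _; rewrite !E.
Qed.

(** Predictability: the arm of round [t] is chosen before the reward of round [t] is seen, hence the
    strict bound on [s]. *)
Lemma eq_ucb_hist Y Y' t : (forall i s, (1 <= s < t)%N -> Y (i, s) = Y' (i, s)) ->
  ucb_hist S Y t = ucb_hist S Y' t.
Proof.
elim: t => //= t IH YY; rewrite -IH.
  rewrite (@eq_ucb_next Y Y')// => i s; rewrite size_ucb_hist => hs; exact: YY.
by move=> i s /andP[s1 st]; apply: YY; rewrite s1 (ltn_trans st).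
Qed.

End Run.
End History.

(** * Measurability of the history *)

Section DiscreteMeasurability.
Context d (T : measurableType d).

(** Measurability for the discrete sigma-algebra on the target, so that sequences and options of
    arms carry no measurable structure of their own. *)
Definition discmeas (D : Type) (f : T -> D) : Prop :=
  forall A : set D, measurable (f @^-1` A).

(** Split along the countably many values of [f]; on each piece the set is one fixed [U x]. *)
Lemma discmeas_preimage (D : countType) (f : T -> D) (U : D -> set T) :
  discmeas f -> (forall x, measurable (U x)) -> measurable [set w | U (f w) w].
Proof.
move=> mf mU.
have -> : [set w | U (f w) w] = \bigcup_x (f @^-1` [set x] `&` U x).
  by apply/seteqP; split=> [w Uw|w [x _ [/= -> //]]]; exists (f w).
apply: countable_bigcupT_measurable => [|x].
  exact: countableP.
by apply: measurableI; [exact: mf|exact: mU].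
Qed.

Lemma discmeas_bind (D : countType) (E : Type) (f : T -> D) (g : D -> T -> E) :
  discmeas f -> (forall x, discmeas (g x)) -> discmeas (fun w => g (f w) w).
Proof.
by move=> mf mg A; apply: (discmeas_preimage (U := fun x => g x @^-1` A)) => // x; exact: mg.
Qed.

Lemma measurable_bind d' (V : measurableType d') (D : countType) (f : T -> D) (g : D -> T -> V) :
  discmeas f -> (forall x, measurable_fun setT (g x)) -> measurable_fun setT (fun w => g (f w) w).
Proof.
move=> mf mg _ B mB; rewrite setTI.
apply: (discmeas_preimage (U := fun x => g x @^-1` B)) => // x.
by have := mg x measurableT B mB; rewrite setTI.
Qed.

Lemma discmeas_bool (f : T -> bool) : measurable_fun setT f -> discmeas f.
Proof. by move=> mf A; have := mf measurableT A; rewrite setTI; apply. Qed.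

Lemma discmeas_ffun (J : finType) (b : J -> T -> bool) : (forall j, discmeas (b j)) ->
  discmeas (fun w => [ffun j => b j w]).
Proof.
move=> mb A.
have -> : (fun w => [ffun j => b j w]) @^-1` A =
   \bigcup_(g : {ffun J -> bool}) (if g \in A then \bigcap_j (b j @^-1` [set g j]) else set0).
  apply/seteqP; split=> [w Aw|w [g _]].
    by exists [ffun j => b j w] => //; rewrite mem_set//= => j _ /=; rewrite ffunE.
  case: ifP => // /set_mem gA bw /=.
  by have -> : [ffun j => b j w] = g by apply/ffunP => j; rewrite ffunE bw.
apply: countable_bigcupT_measurable => [|g]; first exact: countableP.
case: ifP => // _; apply: fin_bigcap_measurable => [|j _]; first exact: finite_finset.
exact: mb.
Qed.

End DiscreteMeasurability.

Section HistoryMeasurability.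
Variables (R : realType) (k : nat).
Context d (T : measurableType d) (p : T -> 'I_k * nat -> R).
Hypothesis mp : forall c, measurable_fun setT (p ^~ c).
Implicit Types (h : seq 'I_k) (i : 'I_k) (S : {set 'I_k}).

Lemma measurable_rsum h i : measurable_fun setT (fun w => rsum (p w) h i).
Proof.
elim/last_ind: h => [|h j IH].
  rewrite (_ : (fun w => _) = cst 0); first exact: measurable_cst.
  by apply/funext => w; rewrite /rsum big_ord0.
rewrite (_ : (fun w => _) = fun w => rsum (p w) h i +
  (if j == i then p w (i, (size h).+1) else 0)); last first.
  by apply/funext => w; rewrite rsum_rcons.
by apply: measurable_funD => //; case: eqP => _; [exact: mp|exact: measurable_cst].
Qed.

Lemma measurable_capsum mu n h i : measurable_fun setT (fun w => capsum mu n i (p w) h).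
Proof.
elim/last_ind: h => [|h j IH].
  rewrite (_ : (fun w => _) = cst 0); first exact: measurable_cst.
  by apply/funext => w; rewrite /capsum big_ord0.
rewrite (_ : (fun w => _) = fun w => capsum mu n i (p w) h +
  (if (j == i) && (npulls h i < n)%N then p w (i, (size h).+1) - mu else 0)); last first.
  by apply/funext => w; rewrite capsum_rcons.
apply: measurable_funD => //; case: (_ && _); last exact: measurable_cst.
by apply: measurable_funB; [exact: mp|exact: measurable_cst].
Qed.

Lemma measurable_ucb_index h i : measurable_fun setT (fun w => ucb_index (p w) h i).
Proof.
apply: measurable_funD; last exact: measurable_cst.
rewrite /empmean; case: eqP => _; first exact: measurable_cst.
by apply: measurable_funM; [exact: measurable_rsum|exact: measurable_cst].
Qed.

Lemma discmeas_ucb_next S h : discmeas (fun w => ucb_next S (p w) h).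
Proof.
(* The choice of arm factors through the finite table of comparisons between indices. *)
pose b (c : 'I_k * 'I_k) w := ucb_index (p w) h c.1 <= ucb_index (p w) h c.2.
have mb : discmeas (fun w => [ffun c => b c w]).
  apply: discmeas_ffun => c; apply: discmeas_bool.
  by apply: measurable_fun_ler; exact: measurable_ucb_index.
pose g (f : {ffun 'I_k * 'I_k -> bool}) :=
  if [pick i in S | npulls h i == 0%N] is Some i then Some i
  else [pick i in S | [forall j in S, f (j, i)]].
have -> : (fun w => ucb_next S (p w) h) = (fun w => g [ffun c => b c w]).
  apply/funext => w; rewrite /g /ucb_next; case: pickP => // _.
  apply: eq_pick => i /=; congr (_ && _); apply: eq_forallb_in => j _.
  by rewrite ffunE.
by move=> A; exact: (mb (g @^-1` A)).
Qed.

Lemma discmeas_ucb_hist S t : discmeas (fun w => ucb_hist S (p w) t).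
Proof.
elim: t => [A|t IH] /=; first by rewrite preimage_cst; case: ifP.
apply: (discmeas_bind (g := fun h w => if ucb_next S (p w) h is Some i then rcons h i else h)) => // h.
by move=> A; exact: (discmeas_ucb_next S h ((fun o => if o is Some i then rcons h i else h) @^-1` A)).
Qed.

End HistoryMeasurability.

(** * Exponential supermartingales *)

Section Supermartingale.
Variables (R : realType) (k : nat) (S : {set 'I_k}) (S0 : (0 < #|S|)%N).
Variables (P : R -> probability R R) (mu : 'I_k -> R).
Hypothesis Psg : forall i (s : R),
  (\int[P (mu i)]_x (expR (s * (x - mu i)))%:E <= (expR (s ^+ 2 / 2))%:E)%E.

(** The usual exponential supermartingale of a 1-subgaussian walk, stopped at the [n]-th pull of
    [i]: [minn] freezes the variance term at the moment when [capsum] freezes the sum. *)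
Definition expmart (i : 'I_k) (n : nat) (l : R) (Y : 'I_k * nat -> R) (h : seq 'I_k) : R :=
  expR (l * capsum (mu i) n i Y h - l ^+ 2 / 2 * (minn (npulls h i) n)%:R).

Lemma fammeas_expmart i n l t : fammeas (fun Y => (expmart i n l Y (ucb_hist S Y t))%:E).
Proof.
move=> d T p mp; apply: measurableT_comp => //.
apply: (measurable_bind (g := fun h w => expmart i n l (p w) h)).
  exact: discmeas_ucb_hist.
move=> h; apply: measurableT_comp; first exact: measurable_expR.
apply: measurable_funB; last exact: measurable_cst.
apply: measurable_funM; first exact: measurable_cst.
exact: measurable_capsum.
Qed.

Lemma mem_coords T (i : 'I_k) t : (0 < t <= T)%N -> (i, t) \in coords k T.
Proof.
move=> tT; apply/allpairsP; exists (i, t); split => //=; first by rewrite mem_enum.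
by rewrite mem_iota; lia.
Qed.

Lemma uniq_coords T : uniq (coords k T).
Proof.
by apply: allpairs_uniq; [exact: enum_uniq|exact: iota_uniq|case=> a b [c d']].
Qed.

(** The past decides whether round [t.+1] is a counted pull of [i]. If it is, the fresh reward
    brings a factor of integral at most [expR (l ^+ 2 / 2)], which the variance term cancels;
    otherwise the value is unchanged. *)
Lemma expmart_step i n l t Y :
  (\int[P (mu i)]_y (expmart i n l (upd Y (i, t.+1) y) (ucb_hist S (upd Y (i, t.+1) y) t.+1))%:E
   <= (expmart i n l Y (ucb_hist S Y t))%:E)%E.
Proof.
set h := ucb_hist S Y t.
have sh : size h = t by exact: size_ucb_hist.
have hist_upd y : ucb_hist S (upd Y (i, t.+1) y) t.+1 = ucb_hist S Y t.+1.
  apply: eq_ucb_hist => // j s hs; rewrite updE; case: eqP => // -[_ st]; lia.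
have cap_upd y : capsum (mu i) n i (upd Y (i, t.+1) y) h = capsum (mu i) n i Y h.
  apply: eq_capsum => s hs; rewrite updE; case: eqP => // -[st]; lia.
have [j nx _] := ucb_nextP S0 Y h.
have nxt : ucb_hist S Y t.+1 = rcons h j by rewrite /= -/h nx.
under eq_integral do rewrite hist_upd nxt.
rewrite /expmart; under eq_integral do rewrite capsum_rcons npulls_rcons cap_upd sh updE eqxx.
have [/andP[/eqP -> hn]|hN] := boolP ((j == i) && (npulls h i < n)%N); last first.
  rewrite integral_prob_cst lee_fin ler_expR addr0 lerD2l lerN2.
  by apply: ler_wpM2l; [rewrite mulr_ge0 ?sqr_ge0|rewrite ler_nat; lia].
have E : minn (npulls h i + (i == i)) n = (minn (npulls h i) n).+1 by rewrite eqxx; lia.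
rewrite E.
set a := capsum _ _ _ _ _; set N := minn _ _.
under eq_integral => y _.
  rewrite (_ : _ - _ = (l * a - l ^+ 2 / 2 * N%:R - l ^+ 2 / 2) + l * (y - mu i)); last first.
    by rewrite -natr1; ring.
  rewrite expRD EFinM; over.
rewrite ge0_integralZl_EFin//=; last first.
  apply: measurableT_comp => //; apply: measurableT_comp; first exact: measurable_expR.
  by apply: measurable_funM => //; exact: measurable_funB.
apply: (@le_trans _ _ ((expR (l * a - l ^+ 2 / 2 * N%:R - l ^+ 2 / 2))%:E *
   (expR (l ^+ 2 / 2))%:E)%E).
  by rewrite lee_pmul2l// lte_fin expR_gt0.
by rewrite -EFinM -expRD subrK.
Qed.

(** Integrating the coordinate [(i, t.+1)] first steps back by one round; at time 0 the value is
    1. *)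
Lemma iint_expmart i n l T t Y : (t <= T)%N ->
  (iint (fun c : 'I_k * nat => P (mu c.1)) (coords k T)
    (fun Y => (expmart i n l Y (ucb_hist S Y t))%:E) Y <= 1)%E.
Proof.
elim: t => [_|t IH tT].
  have E0 Z : expmart i n l Z (ucb_hist S Z 0) = 1.
    by rewrite /expmart /capsum big_ord0 /npulls /= min0n !mulr0 subr0 expR0.
  rewrite (_ : (fun Y => _) = fun=> 1%E) ?iint_cst//.
  by apply/funext => Z; rewrite E0.
apply: le_trans (IH (ltnW tT)).
rewrite (iint_inner _ _ (c := (i, t.+1))).
- by apply: le_iint => Z; exact: expmart_step.
- exact: mem_coords.
- exact: uniq_coords.
- exact: fammeas_expmart.
- by move=> Z; rewrite lee_fin expR_ge0.
Qed.

End Supermartingale.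

(** * Pull counts *)

Section RealEstimates.
Variable R : realType.
Local Notation flog := (@flog R).

Lemma flog_ge1 t : 1 <= flog t.
Proof. by rewrite /flog lerDl mulr_ge0// sqr_ge0. Qed.

Lemma flog_gt0 t : 0 < flog t.
Proof. exact: lt_le_trans ltr01 (flog_ge1 t). Qed.

Lemma le_flog s t : (0 < s <= t)%N -> flog s <= flog t.
Proof.
move=> /andP[s0 st]; rewrite /flog lerD2l.
have s1 : (1 <= s%:R :> R) by rewrite ler1n.
have st' : (s%:R <= t%:R :> R) by rewrite ler_nat.
apply: ler_pM => //; first exact: sqr_ge0.
have l0 : 0 <= ln (s%:R : R) by exact: ln_ge0.
rewrite ler_pXn2r// ?nnegrE//; last by rewrite ln_ge0// ler1n (leq_trans s0).
by rewrite ler_ln// posrE; lra.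
Qed.

(** This is ln (1 + x) <= x at x = -1/(t+1). *)
Lemma ln_succ_sub (t : nat) : (0 < t)%N ->
  (t.+1%:R : R)^-1 <= ln (t.+1%:R : R) - ln (t%:R : R).
Proof.
move=> t0.
have t0' : 0 < (t%:R : R) by rewrite ltr0n.
have i1 : (t.+1%:R : R)^-1 < 1 by rewrite invf_lt1 ?ltr1n.
have := @le_ln1Dx R (- (t.+1%:R)^-1); rewrite ltrN2 => /(_ i1).
have -> : 1 - (t.+1%:R : R)^-1 = t%:R / t.+1%:R.
  by rewrite -natr1; field; rewrite natr1 pnatr_eq0.
rewrite ln_div ?posrE//; first by move: (_^-1) (ln _) (ln _) => v a b; lra.
Qed.

Lemma ln2_ge23 : 2 / 3 <= ln (2 : R).
Proof.
rewrite -ler_expR lnK ?posrE// -[leLHS]invrK -expRN -[leRHS]invrK.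
rewrite lef_pV2 ?posrE ?invr_gt0 ?expR_gt0//.
(* The inequality 1 + x <= exp x at x = -1/15, raised to the tenth power, suffices because
   (14/15)^10 > 1/2. *)
have -> : expR (- (2 / 3)) = expR (- (1 / 15)) ^+ 10 :> R.
  by rewrite -expRM_natl; congr expR; field.
have h : 14 / 15 <= expR (- (1 / 15)) :> R by have := expR_ge1Dx (- (1 / 15) : R); lra.
apply: (@le_trans _ _ ((14 / 15) ^+ 10)); first by lra.
by apply: lerXn2r; rewrite ?nnegrE ?expR_ge0//; lra.
Qed.

(** Telescoping: 1 / (n ln^2 n) is at most 1 / ln (n-1) - 1 / ln n. The induction keeps the
    remainder - 1 / ln T; the constant 3 comes from a first term at most 1 and 1 / ln 2 <= 2. *)
Lemma sum_inv_flog T : \sum_(1 <= t < T) (flog t.+1)^-1 <= 3.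
Proof.
case: T => [|[|T]]; [by rewrite big_geq|by rewrite big_geq|].
suff: \sum_(1 <= t < T.+2) (flog t.+1)^-1 <= 3 - (ln (T.+2%:R : R))^-1.
  move=> H; apply: le_trans H _; rewrite gerBl invr_ge0 ln_ge0// ler1n//.
elim: T => [|T IH].
  rewrite big_nat1.
  have : (flog 2)^-1 <= 1 by rewrite invf_le1 ?flog_gt0 ?flog_ge1.
  have : (ln (2 : R))^-1 <= (1 / 2)^-1.
    by rewrite lef_pV2 ?posrE; have := ln2_ge23; lra.
  by lra.
rewrite big_nat_recr//=.
have la : 0 < ln (T.+2%:R : R) by rewrite ln_gt0// ltr1n.
have lb : 0 < ln (T.+3%:R : R) by rewrite ln_gt0// ltr1n.
have lab := @ln_succ_sub T.+2 isT.
suff : (flog T.+3)^-1 <= (ln (T.+2%:R : R))^-1 - (ln (T.+3%:R : R))^-1 by lra.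
set a := ln (T.+2%:R : R) in la lab *; set b := ln (T.+3%:R : R) in lb lab *.
have n0 : 0 < (T.+3%:R : R) by rewrite ltr0n.
have ab : a <= b.
  have : 0 < (T.+3%:R : R)^-1 by rewrite invr_gt0.
  by move: lab; move: (_^-1) => v; lra.
have -> : a^-1 - b^-1 = (b - a) / (a * b) by field; rewrite !gt_eqF.
apply: (@le_trans _ _ ((T.+3%:R)^-1 / b ^+ 2)).
  rewrite -invfM lef_pV2 ?posrE ?flog_gt0//; last by rewrite mulr_gt0 ?exprn_gt0.
  by rewrite /flog -/b; lra.
apply: ler_pM => //.
  by rewrite invr_ge0 sqr_ge0.
rewrite lef_pV2 ?posrE ?mulr_gt0 ?exprn_gt0//.
by rewrite expr2 ler_pM2r.
Qed.

(** A geometric series, with 1 + a <= exp a; the induction keeps the remainder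
    [expR (- (N%:R * a))]. *)
Lemma sum_expRN (a : R) N : 0 < a -> \sum_(1 <= n < N) expR (- (n%:R * a)) <= a^-1.
Proof.
move=> a0; case: N => [|N]; first by rewrite big_geq// invr_ge0 ltW.
rewrite -[leRHS]mul1r ler_pdivlMr//.
suff : (\sum_(1 <= n < N.+1) expR (- (n%:R * a))) * a <= 1 - expR (- (N%:R * a)).
  by have := expR_gt0 (- (N%:R * a)); lra.
elim: N => [|N IH]; first by rewrite big_geq// !mul0r oppr0 expR0 subrr.
rewrite big_nat_recr//= mulrDl.
have E : expR (- (N%:R * a)) = expR (- (N.+1%:R * a)) * expR a.
  by rewrite -expRD -natr1; congr expR; ring.
have H : expR (- (N.+1%:R * a)) * (1 + a) <= expR (- (N%:R * a)).
  by rewrite E ler_pM2l ?expR_gt0// expR_ge1Dx.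
by lra.
Qed.

End RealEstimates.

Section PullCount.
Variables (R : realType) (k : nat) (S : {set 'I_k}) (S0 : (0 < #|S|)%N).
Variables (mu : 'I_k -> R) (T : nat).

(** A deviation seen at round [t] is transported to the horizon, where it is controlled by a
    supermartingale indexed by the pull count [n]. *)
Lemma capsum_prefix n i t (Y : 'I_k * nat -> R) : (t <= T)%N ->
  npulls (ucb_hist S Y t) i = n ->
  capsum (mu i) n i Y (ucb_hist S Y T) = rsum Y (ucb_hist S Y t) i - mu i * n%:R /\
  minn (npulls (ucb_hist S Y T) i) n = n.
Proof.
move=> tT hn.
have E := cat_take_drop t (ucb_hist S Y T); rewrite (ucb_hist_take S0)// in E.
rewrite -E capsum_cat ?capsumE ?hn//; split=> //.
by rewrite npulls_cat hn; lia.
Qed.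

(* Pointwise Chernoff bound: the indicator of a deviation is at most a multiple
   of [expmart], whose integral is at most 1. *)
Lemma expmart_markov n i (x l s : R) (Y : 'I_k * nat -> R) h :
  l = s * x -> s ^+ 2 = 1 -> 0 <= x -> n%:R * x <= s * capsum (mu i) n i Y h ->
  minn (npulls h i) n = n ->
  1 <= expR (- (n%:R * (x ^+ 2 / 2))) * expmart mu i n l Y h.
Proof.
move=> -> s1 x0 hx hn; rewrite /expmart hn -expRD -[leLHS]expR0 ler_expR exprMn s1 mul1r.
have := ler_wpM2r x0 hx; set c := capsum _ _ _ _ _; set N := (n%:R : R).
by nra.
Qed.

(** How far the empirical mean of the better arm lies below its mean, after [n] pulls, when its
    index falls short by [D]. A history of length [t] uses the confidence width of round [t.+1]. *)
Definition dev (D : R) (t n : nat) : R := Num.sqrt (2 * ln (flog R t.+1) / n%:R) + D.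

(** A pull of [i] is one of its first [u], or the index of [b] is below [mu b - D], or the empirical
    mean of [i] is at least [mu i + D]. The last two events are charged to [expmart] through the
    Chernoff bound. *)
Lemma npulls_bound i b (D : R) (u : nat) Y (h := ucb_hist S Y T) : i \in S -> b \in S -> 0 < D ->
  mu b - mu i = 4 * D -> (0 < u)%N -> ln (flog R T) <= u%:R * (2 * D ^+ 2) ->
  (npulls h i)%:R <= u%:R
    + \sum_(1 <= n < T.+1) expR (- (n%:R * (D ^+ 2 / 2))) * expmart mu i n D Y h
    + \sum_(1 <= t < T) \sum_(1 <= n < T.+1)
        expR (- (n%:R * (dev D t n ^+ 2 / 2))) * expmart mu b n (- dev D t n) Y h.
Proof.
move=> iS bS D0 gap u0 hu.
pose E1 n := expR (- (n%:R * (D ^+ 2 / 2))) * expmart mu i n D Y h.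
pose E2 t n := expR (- (n%:R * (dev D t n ^+ 2 / 2))) * expmart mu b n (- dev D t n) Y h.
have E1p n : 0 <= E1 n by rewrite mulr_ge0 ?expR_ge0.
have E2p t n : 0 <= E2 t n by rewrite mulr_ge0 ?expR_ge0.
(* [g] pays for the early pulls and for overestimating [i], [F] for underestimating [b]. The values
   [n = 0] and [t = 0] belong to the first [u] pulls. *)
pose g (n : nat) : R := (n < u)%:R + (0 < n)%:R * E1 n.
pose F (t : nat) : R := (0 < t)%:R * \sum_(1 <= n < T.+1) E2 t n.
have Fp t : 0 <= F t by rewrite mulr_ge0// sumr_ge0.
have sh : size h = T by exact: size_ucb_hist.
have key (t : 'I_(size h)) : nth i h t == i -> 1 <= g (npulls (take t h) i) + F t.
  move=> /eqP hti; have tT : (t < T)%N by rewrite -sh.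
  rewrite (ucb_hist_take S0 Y (ltnW tT)); set ht := ucb_hist S Y t.
  have st : size ht = t by exact: size_ucb_hist.
  have := nth_ucb_hist S0 Y i tT; rewrite hti -/ht => nx.
  rewrite /g; case: ltnP => [_|Nu]; first by rewrite -addrA lerDl addr_ge0// mulr_ge0.
  have N0 : (0 < npulls ht i)%N by lia.
  have t0 : (0 < t)%N.
    have := count_size (pred1 i) ht; rewrite -/(npulls ht i) st; lia.
  have [j] := ucb_nextP S0 Y ht; rewrite nx => -[<-] [_ []]; first by lia.
  move=> /(_ b bS) [Nb0]; rewrite /ucb_index /empmean !gtn_eqF// st => idx.
  rewrite N0 /F t0 !mul1r add0r.
  set f := ln (flog R t.+1) in idx.
  have fT : f <= ln (flog R T) by rewrite ler_ln ?posrE ?flog_gt0// le_flog.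
  have f0 : 0 <= f by rewrite ln_ge0// flog_ge1.
  have [c1 m1] := capsum_prefix (ltnW tT) (erefl (npulls ht i)).
  have [c2 m2] := capsum_prefix (ltnW tT) (erefl (npulls ht b)).
  (* If [b] is not underestimated, the chosen arm [i] has index at least [mu b - D], that is
     [mu i + 3 * D]. *)
  have [low|high] := ltP (rsum Y ht b / (npulls ht b)%:R + Num.sqrt (2 * f / (npulls ht b)%:R)) (mu b - D).
    have bT : (npulls ht b < T.+1)%N.
      by have := count_size (pred1 b) ht; rewrite -/(npulls ht b) st; lia.
    rewrite (bigD1_seq (npulls ht b)) ?mem_index_iota ?Nb0 ?iota_uniq//=.
    suff : 1 <= E2 t (npulls ht b).
      have : 0 <= \sum_(1 <= j < T.+1 | j != npulls ht b) E2 t j by rewrite sumr_ge0.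
      by have := E1p (npulls ht i); lra.
    apply: (@expmart_markov _ _ (dev D t (npulls ht b)) _ (-1)) => //.
    - by rewrite mulN1r.
    - by rewrite sqrrN expr1n.
    - by rewrite addr_ge0 ?sqrtr_ge0 ?ltW.
    - rewrite c2 /dev -/f; set N : R := (npulls ht b)%:R in low *.
      have NR : 0 < N by rewrite ltr0n.
      set q := Num.sqrt _ in low *.
      have : rsum Y ht b / N < mu b - D - q by lra.
      by rewrite ltr_pdivrMr//; lra.
  suff : 1 <= E1 (npulls ht i).
    have : 0 <= \sum_(1 <= n < T.+1) E2 t n by rewrite sumr_ge0.
    by lra.
  apply: (@expmart_markov _ _ D _ 1) => //.
  - by rewrite mul1r.
  - by rewrite expr1n.
  - exact: ltW.
  - rewrite mul1r c1; set N : R := (npulls ht i)%:R in idx *.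
    have NR : 0 < N by rewrite ltr0n.
    have uN : u%:R <= N by rewrite ler_nat.
    (* After [u] pulls the confidence width is at most [2 * D], which leaves an empirical mean of at
       least [mu i + D]. *)
    have q2 : Num.sqrt (2 * f / N) <= 2 * D.
      rewrite -[leRHS]ger0_norm; last by lra.
      rewrite -sqrtr_sqr ler_wsqrtr// ler_pdivrMr//.
      have : u%:R * (2 * D ^+ 2) <= N * (2 * D ^+ 2).
        by rewrite ler_pM2r// mulr_gt0 ?exprn_gt0.
      by rewrite exprMn; lra.
    have : mu i + D <= rsum Y ht i / N by lra.
    by rewrite ler_pdivlMr//; lra.
have -> : (npulls h i)%:R = \sum_(s < size h | nth i h s == i) (1 : R).
  by rewrite (sum_pulls h i (fun=> 1)) sumr_const card_ord.
apply: (@le_trans _ _ (\sum_(s < size h | nth i h s == i) (g (npulls (take s h) i) + F s))).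
  exact: ler_sum.
(* [g] is summed once per pull count of [i], [F] at most once per round. *)
rewrite big_split /= sum_pulls; apply: lerD.
  apply: (@le_trans _ _ (\sum_(0 <= n < T.+1) g n)).
    rewrite -(big_mkord xpredT g).
    have NT : (npulls h i <= T.+1)%N.
      by have := count_size (pred1 i) h; rewrite -/(npulls h i) sh; lia.
    rewrite [leRHS](big_cat_nat (n := npulls h i))//= lerDl sumr_ge0// => n _.
    by rewrite addr_ge0// mulr_ge0.
  rewrite big_split /=; apply: lerD.
    have : (\sum_(0 <= n < T.+1) (n < u) <= u)%N.
      rewrite (big_cat_nat (n := minn u T.+1))//=; last exact: geq_minr.
      rewrite [X in (_ + X)%N]big_nat_cond [X in (_ + X)%N]big1 ?addn0; last first.
        by move=> n; rewrite andbT; lia.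
      apply: (@leq_trans (\sum_(0 <= n < minn u T.+1) 1)%N).
        by apply: leq_sum => n _; case: (n < u)%N.
      by rewrite sum_nat_const_nat subn0 muln1 geq_minl.
    by rewrite -(ler_nat R) natr_sum.
  rewrite big_nat_recl//= mul0r add0r big_add1.
  by apply: ler_sum => n _; rewrite mul1r.
rewrite big_mkcond.
apply: (@le_trans _ _ (\sum_(s < size h) F s)).
  by apply: ler_sum => s _; case: ifP.
rewrite sh -(big_mkord xpredT F).
have -> : \sum_(0 <= t < T) F t = \sum_(1 <= t < T) F t.
  by case: (T) => [|T']; [rewrite !big_geq|rewrite big_nat_recl// big_add1 /F mul0r add0r].
by apply: ler_sum_nat => t /andP[t1 _]; rewrite /F t1 mul1r.
Qed.

End PullCount.

Section IteratedIntegralReal.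
Variables (R : realType) (I : eqType) (Q : I -> probability R R).

Lemma le_iint_sum cs (A : eqType) (s : seq A) (F : A -> (I -> R) -> R) (e : A -> R) Y :
  (forall a, fammeas (fun Y => (F a Y)%:E)) -> (forall a Y, 0 <= F a Y) ->
  (forall a, a \in s -> (iint Q cs (fun Y => (F a Y)%:E) Y <= (e a)%:E)%E) ->
  (iint Q cs (fun Y => (\sum_(a <- s) F a Y)%:E) Y <= (\sum_(a <- s) e a)%:E)%E.
Proof.
move=> mF F0 Fe.
rewrite (_ : (fun Y => _) = fun Y => (\sum_(a <- s) (F a Y)%:E)%E); last first.
  by apply/funext => Z; rewrite sumEFin.
rewrite iint_sum// -sumEFin !big_seq; exact: lee_sum.
Qed.

Lemma le_iint_scale cs (c e : R) F Y : fammeas (fun Y => (F Y)%:E) ->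
  (forall Y, 0 <= F Y) -> 0 <= c -> (iint Q cs (fun Y => (F Y)%:E) Y <= e%:E)%E ->
  (iint Q cs (fun Y => (c * F Y)%:E) Y <= (c * e)%:E)%E.
Proof.
move=> mF F0 c0 Fe.
rewrite (_ : (fun Y => _) = fun Y => (c%:E * (F Y)%:E)%E); last first.
  by apply/funext => Z; rewrite EFinM.
by rewrite iintZ// EFinM lee_wpmul2l.
Qed.

Lemma fammeas_scale (c : R) (F : (I -> R) -> R) : fammeas (fun Y => (F Y)%:E) ->
  fammeas (fun Y => (c * F Y)%:E).
Proof. by move=> mF; under eq_fun do rewrite EFinM; exact: (fammeasZ c%:E mF). Qed.

Lemma fammeas_rsum (A : Type) (s : seq A) (F : A -> (I -> R) -> R) :
  (forall a, fammeas (fun Y => (F a Y)%:E)) -> fammeas (fun Y => (\sum_(a <- s) F a Y)%:E).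
Proof. by move=> mF; under eq_fun do rewrite -sumEFin; exact: (fammeas_sum s mF). Qed.

End IteratedIntegralReal.

Lemma fammeas_hist (R : realType) k (S : {set 'I_k}) t (g : seq 'I_k -> R) :
  fammeas (fun Y : 'I_k * nat -> R => (g (ucb_hist S Y t))%:E).
Proof.
move=> d T p mp; apply: measurableT_comp => //.
apply: (measurable_bind (g := fun h _ => g h)); first exact: discmeas_ucb_hist.
by move=> h; exact: measurable_cst.
Qed.

Section ExpectedPulls.
Variables (R : realType) (k : nat) (S : {set 'I_k}) (S0 : (0 < #|S|)%N).
Variables (P : R -> probability R R) (mu : 'I_k -> R) (T : nat).
Hypothesis Psg : forall i (s : R),
  (\int[P (mu i)]_x (expR (s * (x - mu i)))%:E <= (expR (s ^+ 2 / 2))%:E)%E.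
Local Notation E F := (iint (fun c : 'I_k * nat => P (mu c.1)) (coords k T) F (fun=> 0)).
Local Notation L := (ln (flog R T)).

(** Take [u] just above [L / 2 / D ^+ 2]. Overestimating [i] costs a geometric series, at most
    [2 / D ^+ 2]; underestimating [b] costs the same series weighted by 1 / f(t+1), at most three
    times as much. *)
Lemma iint_npulls_le i b (D : R) : i \in S -> b \in S -> 0 < D -> mu b - mu i = 4 * D ->
  (E (fun Y => (npulls (ucb_hist S Y T) i)%:R%:E) <= (1 + (L / 2 + 8) / D ^+ 2)%:E)%E.
Proof.
move=> iS bS D0 gap.
have L0 : 0 <= L by rewrite ln_ge0// flog_ge1.
have D2 : 0 < D ^+ 2 by rewrite exprn_gt0.
have x0 : 0 <= L / 2 / D ^+ 2 by rewrite !mulr_ge0// invr_ge0 ltW.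
pose u := (Num.truncn (L / 2 / D ^+ 2)).+1.
have [ul uu] : L / 2 / D ^+ 2 < u%:R /\ u%:R <= L / 2 / D ^+ 2 + 1.
  by have /andP[? ?] := truncn_itv x0; rewrite /u; split => //; rewrite -natr1; lra.
have hu : L <= u%:R * (2 * D ^+ 2).
  by move: ul; rewrite ltr_pdivrMr//; lra.
have q : 0 < D ^+ 2 / 2 by rewrite divr_gt0.
apply: (@le_trans _ _ (u%:R + 2 / D ^+ 2 + 3 * (2 / D ^+ 2))%:E); last first.
  rewrite lee_fin mulrDl; lra.
pose G1 (Y : 'I_k * nat -> R) := \sum_(1 <= n < T.+1)
  expR (- (n%:R * (D ^+ 2 / 2))) * expmart mu i n D Y (ucb_hist S Y T).
pose G2 t (Y : 'I_k * nat -> R) := \sum_(1 <= n < T.+1)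
  expR (- (n%:R * (dev D t n ^+ 2 / 2))) * expmart mu b n (- dev D t n) Y (ucb_hist S Y T).
apply: (@le_trans _ _ (E (fun Y => (u%:R%:E + (G1 Y)%:E) + (\sum_(1 <= t < T) G2 t Y)%:E)%E)).
  apply: le_iint => Y; rewrite -!EFinD lee_fin.
  exact: (npulls_bound S0 Y iS bS D0 gap (ltn0Sn _) hu).
have mart j n l : fammeas (fun Y => (expmart mu j n l Y (ucb_hist S Y T))%:E).
  exact: fammeas_expmart.
have m1 : fammeas (fun Y => (G1 Y)%:E).
  by apply: fammeas_rsum => n; exact: fammeas_scale.
have m2 t : fammeas (fun Y => (G2 t Y)%:E).
  by apply: fammeas_rsum => n; exact: fammeas_scale.
have p0 j n l x Y : 0 <= expR x * expmart mu j n l Y (ucb_hist S Y T).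
  by rewrite mulr_ge0 ?expR_ge0.
have G1p Y : (0 <= (G1 Y)%:E)%E by rewrite lee_fin sumr_ge0.
have G2p Y : (0 <= (\sum_(1 <= t < T) G2 t Y)%:E)%E.
  by rewrite lee_fin sumr_ge0// => t _; rewrite sumr_ge0.
have m3 : fammeas (fun Y => (\sum_(1 <= t < T) G2 t Y)%:E) by apply: fammeas_rsum.
have mu0 : fammeas (fun Y : 'I_k * nat -> R => (u%:R%:E + (G1 Y)%:E)%E).
  by apply: fammeasD => //; exact: fammeas_cst.
rewrite iintD//; last by move=> Y; rewrite adde_ge0.
rewrite iintD//.
rewrite iint_cst !EFinD; apply: leeD; first apply: leeD => //.
  apply: (@le_trans _ _ (\sum_(1 <= n < T.+1) expR (- (n%:R * (D ^+ 2 / 2))) * 1)%:E).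
    apply: le_iint_sum => [n|n Y|n _]; [exact: fammeas_scale|exact: p0|].
    by apply: le_iint_scale; rewrite ?expR_ge0//; [move=> Y; exact: expR_ge0|exact: iint_expmart].
  rewrite lee_fin; under eq_bigr do rewrite mulr1.
  by apply: le_trans (sum_expRN _ q) _; rewrite invf_div.
apply: (@le_trans _ _ (\sum_(1 <= t < T) (flog R t.+1)^-1 * (2 / D ^+ 2))%:E); last first.
  rewrite lee_fin -mulr_suml ler_wpM2r ?sum_inv_flog// mulr_ge0// invr_ge0 ltW//.
apply: le_iint_sum => [//|t Y|t _]; first by rewrite sumr_ge0.
apply: (@le_trans _ _ (\sum_(1 <= n < T.+1) expR (- (n%:R * (dev D t n ^+ 2 / 2))) * 1)%:E).
  apply: le_iint_sum => [n|n Y|n _]; [exact: fammeas_scale|exact: p0|].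
  by apply: le_iint_scale; rewrite ?expR_ge0//; [move=> Y; exact: expR_ge0|exact: iint_expmart].
rewrite lee_fin.
(* Expanding the square in [dev] and dropping the nonnegative cross term splits the exponential into
   1 / f(t+1) and a geometric term. *)
apply: (@le_trans _ _ (\sum_(1 <= n < T.+1) (flog R t.+1)^-1 * expR (- (n%:R * (D ^+ 2 / 2))))).
  apply: ler_sum_nat => n /andP[n1 _]; rewrite mulr1.
  have n0 : 0 < (n%:R : R) by rewrite ltr0n.
  rewrite -{1}(lnK (flog_gt0 R t.+1)) -expRN -expRD ler_expR -opprD lerN2.
  have f0 : 0 <= ln (flog R t.+1) by rewrite ln_ge0// flog_ge1.
  rewrite /dev; set f := ln _ in f0 *.
  have q0 : 0 <= 2 * f / n%:R by rewrite !mulr_ge0// invr_ge0 ltW.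
  have sq := sqr_sqrtr q0.
  have s0 := sqrtr_ge0 (2 * f / n%:R); set r := Num.sqrt _ in sq s0 *.
  have E : n%:R * r ^+ 2 = 2 * f by rewrite sq; field; rewrite gt_eqF.
  have : 0 <= n%:R * (r * D) by rewrite !mulr_ge0// ltW.
  by rewrite sqrrD; lra.
rewrite -mulr_sumr ler_wpM2l ?invr_ge0 ?(ltW (flog_gt0 R _))//.
by apply: le_trans (sum_expRN _ q) _; rewrite invf_div.
Qed.

End ExpectedPulls.

(** * Regret on a fixed subset of arms *)

Section SubsetRegret.
Variables (R : realType) (k : nat) (S : {set 'I_k}) (S0 : (0 < #|S|)%N).

Lemma sum_npulls (g : 'I_k -> R) h : {subset h <= S} ->
  \sum_(i in S) g i * (npulls h i)%:R = \sum_(j <- h) g j.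
Proof.
elim: h => [|j h IH] hS.
  by rewrite big_nil big1// => i _; rewrite mulr0.
rewrite big_cons -IH; last by move=> i ih; apply: hS; rewrite in_cons ih orbT.
have jS : j \in S by apply: hS; rewrite in_cons eqxx.
under eq_bigr do rewrite /npulls /= natrD mulrDr.
rewrite big_split /= (bigD1 j)//= eqxx mulr1 big1 ?addr0// => i /andP[_ /negbTE ij].
by rewrite eq_sym ij mulr0.
Qed.

Variables (P : R -> probability R R) (mu : 'I_k -> R) (T : nat).
Hypothesis mu01 : forall i, 0 <= mu i <= 1.
Hypothesis Psg : forall i (s : R),
  (\int[P (mu i)]_x (expR (s * (x - mu i)))%:E <= (expR (s ^+ 2 / 2))%:E)%E.
Local Notation E F := (iint (fun c : 'I_k * nat => P (mu c.1)) (coords k T) F (fun=> 0)).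
Local Notation L := (ln (flog R T)).

Lemma mean_pulled_ge0 Y t : 0 <= mean_pulled mu S Y T t.
Proof. by rewrite /mean_pulled; case: onth => //= i; case/andP: (mu01 i). Qed.

Lemma sum_mean_pulled Y :
  \sum_(1 <= t < T.+1) mean_pulled mu S Y T t = \sum_(j <- ucb_hist S Y T) mu j.
Proof.
rewrite big_add1 /= /mean_pulled; set h := ucb_hist S Y T.
have -> : T = size h by rewrite size_ucb_hist.
elim: (h) => [|j h' IH]; first by rewrite big_nil big_geq.
by rewrite big_cons -IH /= big_nat_recl//.
Qed.

(** The three costs: all sampled means below [1 - theta]; arms within [10 * theta] of 1; the other
    arms, whose pull count is of order a / (1 - mu)^2. *)
Definition subset_regret_bound (theta a : R) : R :=
  T%:R * \prod_(i in S) (mu i < 1 - theta)%R%:R + 10 * theta * T%:R +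
  \sum_(i in S) (10 * theta < 1 - mu i)%R%:R * (1 + a / (1 - mu i)).

(** Losses are measured against the mean 1 rather than the best arm, so the total loss is the sum
    over arms of [1 - mu i] times the expected pull count. *)
Lemma sum_iint_mean_ge theta : 0 < theta ->
  ((T%:R - subset_regret_bound theta ((8 * L + 128) * (100 / 81)))%:E <=
   \sum_(1 <= t < T.+1) E (fun Y => (mean_pulled mu S Y T t)%:E))%E.
Proof.
move=> th0.
set a := (8 * L + 128) * (100 / 81).
have L0 : 0 <= L by rewrite ln_ge0// flog_ge1.
have a0 : 0 <= a by rewrite /a; lra.
pose N i (Y : 'I_k * nat -> R) : R := (npulls (ucb_hist S Y T) i)%:R.
have N0 i Y : 0 <= N i Y by rewrite ler0n.
have mN i : fammeas (fun Y => (N i Y)%:E).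
  exact: (fammeas_hist S T (fun h => (npulls h i)%:R)).
have mM t : fammeas (fun Y => (mean_pulled mu S Y T t)%:E).
  exact: (fammeas_hist S T (fun h => oapp mu 0 (onth h t.-1))).
have EN0 i : (0 <= E (fun Y => (N i Y)%:E))%E by apply: iint_ge0 => Y; rewrite lee_fin.
have NT Y : \sum_(i in S) N i Y = T%:R.
  rewrite -(size_ucb_hist S0 Y T) -sum1_size natr_sum.
  rewrite -(sum_npulls (fun=> 1)); last by move=> i; exact: ucb_hist_sub.
  by apply: eq_bigr => i _; rewrite mul1r.
have ENT : (\sum_(i <- enum S) E (fun Y => (N i Y)%:E))%E = T%:R%:E.
  rewrite -iint_sum//.
  rewrite -[RHS](@iint_cst R _ (fun c : 'I_k * nat => P (mu c.1)) (coords k T) T%:R%:E (fun=> 0)).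
  by congr (iint _ _ _ _); apply/funext => Y; rewrite sumEFin big_enum NT.
have ENfin i : i \in S -> E (fun Y => (N i Y)%:E) \is a fin_num.
  move=> iS; rewrite ge0_fin_numE//; apply: (@le_lt_trans _ _ T%:R%:E); last exact: ltry.
  rewrite -ENT (bigD1_seq i) ?enum_uniq ?mem_enum//= leeDl// sume_ge0//.
pose n i := fine (E (fun Y => (N i Y)%:E)).
have nE i : i \in S -> E (fun Y => (N i Y)%:E) = (n i)%:E by move=> iS; rewrite fineK// ENfin.
have n0 i : 0 <= n i by exact: fine_ge0.
have nT : \sum_(i in S) n i = T%:R.
  apply: EFin_inj; rewrite -ENT -sumEFin big_enum /=.
  by apply: eq_bigr => i iS; rewrite nE.
have r0 i : 0 <= 1 - mu i by have := mu01 i; lra.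
(* Means and losses add up to [T]; writing this as a sum of nonnegative terms allows linearity of
   [iint], and the finite loss is subtracted afterwards. *)
have total : ((\sum_(1 <= t < T.+1) E (fun Y => (mean_pulled mu S Y T t)%:E)) +
    (\sum_(i in S) (1 - mu i) * n i)%:E = T%:R%:E)%E.
  have -> : ((\sum_(i in S) (1 - mu i) * n i)%:E =
     E (fun Y => (\sum_(i <- enum S) (1 - mu i)%:E * (N i Y)%:E)))%E.
    rewrite iint_sum; last 2 first.
    - by move=> i; exact: fammeasZ.
    - by move=> i Y; rewrite mule_ge0// lee_fin.
    rewrite -sumEFin big_enum /=; apply: eq_bigr => i iS.
    have c0 : (0 <= (1 - mu i)%:E)%E by rewrite lee_fin.
    have m0 Y : (0 <= (N i Y)%:E)%E by rewrite lee_fin.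
    by rewrite iintZ// nE.
  rewrite -iint_sum//; last by move=> t Y; rewrite lee_fin mean_pulled_ge0.
  rewrite -iintD; first last.
  - by move=> Y; apply: sume_ge0 => i _; rewrite mule_ge0// lee_fin.
  - by move=> Y; apply: sume_ge0 => t _; rewrite lee_fin mean_pulled_ge0.
  - by apply: fammeas_sum => i; exact: fammeasZ.
  - exact: fammeas_sum.
  rewrite -[RHS](@iint_cst R _ (fun c : 'I_k * nat => P (mu c.1)) (coords k T) T%:R%:E (fun=> 0)).
  congr (iint _ _ _ _); apply/funext => Y.
  rewrite big_enum /=; under [X in (_ + X)%E]eq_bigr do rewrite -EFinM.
  rewrite !sumEFin -EFinD sum_mean_pulled /N sum_npulls; last by move=> i; exact: ucb_hist_sub.
  rewrite -big_split /=; under eq_bigr do rewrite addrC subrK.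
  by rewrite big_const_seq count_predT iter_addr addr0 size_ucb_hist.
suff H : \sum_(i in S) (1 - mu i) * n i <= subset_regret_bound theta a.
  have -> : (\sum_(1 <= t < T.+1) E (fun Y => (mean_pulled mu S Y T t)%:E) =
     (T%:R - \sum_(i in S) (1 - mu i) * n i)%:E)%E.
    by rewrite EFinB -total addeK.
  by rewrite lee_fin; lra.
have mid0 : 0 <= 10 * theta * T%:R by rewrite mulr_ge0// mulr_ge0// ltW.
have last0 : 0 <= \sum_(i in S) (10 * theta < 1 - mu i)%R%:R * (1 + a / (1 - mu i)).
  by apply: sumr_ge0 => i _; rewrite mulr_ge0// addr_ge0// divr_ge0.
(* With no arm above [1 - theta] the product of indicators is 1, and the first summand is all of
   [T]. *)
have [good|bad] := boolP [exists b in S, 1 - theta <= mu b]; last first.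
  have p1 : \prod_(i in S) (mu i < 1 - theta)%R%:R = 1 :> R.
    rewrite big1// => i iS; rewrite ltNge; case: leP => // h.
    by case/negP: bad; apply/exists_inP; exists i.
  rewrite /subset_regret_bound p1 mulr1 -addrA.
  apply: (@le_trans _ _ T%:R); last by rewrite lerDl addr_ge0.
  rewrite -nT; apply: ler_sum => i _; rewrite ler_piMl//.
  by have := mu01 i; lra.
have /exists_inP[b bS hb] := good.
rewrite /subset_regret_bound -addrA.
apply: (@le_trans _ _ (10 * theta * T%:R + \sum_(i in S) (10 * theta < 1 - mu i)%R%:R * (1 + a / (1 - mu i)))); last first.
  by rewrite lerDr mulr_ge0// prodr_ge0.
rewrite -nT mulr_sumr -big_split /=; apply: ler_sum => i iS.
case: ltP => hi; last by rewrite mul0r addr0 ler_wpM2r.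
rewrite mul1r -[leLHS]add0r lerD//; first by rewrite mulr_ge0// mulr_ge0// ltW.
set r := 1 - mu i in hi *.
have rp : 0 < r by lra.
pose D := (mu b - mu i) / 4.
(* As [1 - mu b <= theta < r / 10], the gap [4 * D] is at least [9 / 10 * r]. The constant [a] is
   exactly [(L / 2 + 8) / (9 / 40) ^+ 2]. *)
have Dr : 9 / 40 * r <= D by rewrite /D /r; rewrite /r in hi; lra.
have D0 : 0 < D by lra.
have H := iint_npulls_le S0 T Psg iS bS D0.
have {H} : n i <= 1 + (L / 2 + 8) / D ^+ 2.
  by rewrite -lee_fin -nE//; apply: H; rewrite /D; field.
move=> H; have r1 : r <= 1 by rewrite /r; have := mu01 i; lra.
apply: le_trans (ler_wpM2l (ltW rp) H) _.
rewrite mulrDr mulr1 lerD//.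
have D2 : (9 / 40 * r) ^+ 2 <= D ^+ 2 by rewrite ler_pXn2r ?nnegrE//; lra.
have r2 : 0 < (9 / 40 * r) ^+ 2 by rewrite exprn_gt0//; lra.
apply: (@le_trans _ _ (r * ((L / 2 + 8) / (9 / 40 * r) ^+ 2))).
  rewrite ler_pM2l// ler_pM2l; last lra.
  by rewrite lef_pV2 ?posrE// (lt_le_trans r2).
rewrite le_eqVlt; apply/orP; left; apply/eqP; rewrite /a; field.
by rewrite gt_eqF.
Qed.

End SubsetRegret.

(** * Averaging over subsets and over the prior *)

Section SubsampledRegret.
Variables (R : realType) (k m T : nat) (P : R -> probability R R) (mu : 'I_k -> R).
Hypothesis mu01 : forall i, 0 <= mu i <= 1.

Lemma bigmax_mu_le1 : \big[Num.max/0]_(i < k) mu i <= 1.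
Proof. by apply: bigmax_le => // i _; case/andP: (mu01 i). Qed.

Lemma ssucb_exp_mean_ge0 t : (0 <= ssucb_exp_mean P m T mu t)%E.
Proof.
rewrite /ssucb_exp_mean mule_ge0 ?lee_fin ?invr_ge0//.
apply: sume_ge0 => S _; apply: iint_ge0 => Y.
by rewrite lee_fin mean_pulled_ge0.
Qed.

Lemma ssucb_regret_leT : (ssucb_regret P m T mu <= T%:R%:E)%E.
Proof.
rewrite /ssucb_regret -[leRHS]sube0; apply: leeB.
  by rewrite lee_fin ler_piMr// bigmax_mu_le1.
by apply: sume_ge0 => t _; exact: ssucb_exp_mean_ge0.
Qed.

Hypothesis Psg : forall i (s : R),
  (\int[P (mu i)]_x (expR (s * (x - mu i)))%:E <= (expR (s ^+ 2 / 2))%:E)%E.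
Hypotheses (m0 : (0 < m)%N) (mk : (m <= k)%N).

Definition msets : {set {set 'I_k}} := [set A : {set 'I_k} | #|A| == m]%SET.

Lemma card_msets_gt0 : 0 < (#|msets|%:R : R).
Proof. by rewrite ltr0n card_draws card_ord bin_gt0. Qed.

(* [Defs] counts the [m]-subsets through a classical set. *)
Lemma card_msetsE : #|[set S : {set 'I_k} | #|S| == m]| = #|msets|.
Proof.
apply: eq_card => S; rewrite finset.inE.
by apply/idP/idP => [/set_mem|h] //; rewrite mem_set.
Qed.

Lemma ssucb_regret_le theta : 0 < theta ->
  (ssucb_regret P m T mu <= (#|msets|%:R^-1 * \sum_(S in msets)
    subset_regret_bound S mu T theta ((8 * ln (flog R T) + 128) * (100 / 81)))%:E)%E.
Proof.
move=> th0; set a := _ * (100 / 81).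
have N0 := card_msets_gt0.
rewrite /ssucb_regret.
have -> : (\sum_(1 <= t < T.+1) ssucb_exp_mean P m T mu t =
   (#|msets|%:R^-1)%:E * \sum_(S in msets) \sum_(1 <= t < T.+1)
      iint (fun c : 'I_k * nat => P (mu c.1)) (coords k T)
        (fun Y => (mean_pulled mu S Y T t)%:E) (fun _ => 0%R))%E.
  rewrite exchange_big /= ge0_sume_distrr; last first.
    by move=> t _; apply: sume_ge0 => S _; apply: iint_ge0 => Y; rewrite lee_fin mean_pulled_ge0.
  apply: eq_bigr => t _; rewrite /ssucb_exp_mean muleC card_msetsE; congr (_ * _)%E.
  by apply: eq_bigl => S; rewrite finset.inE.
have lower : ((#|msets|%:R^-1 * \sum_(S in msets) (T%:R - subset_regret_bound S mu T theta a))%:E <=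
   (#|msets|%:R^-1)%:E * \sum_(S in msets) \sum_(1 <= t < T.+1)
      iint (fun c : 'I_k * nat => P (mu c.1)) (coords k T)
        (fun Y => (mean_pulled mu S Y T t)%:E) (fun _ => 0%R))%E.
  rewrite EFinM; apply: lee_wpmul2l; first by rewrite lee_fin invr_ge0 ltW.
  rewrite -sumEFin; apply: lee_sum => S; rewrite finset.inE => /eqP Sm.
  by apply: sum_iint_mean_ge => //; rewrite Sm.
apply: le_trans (leeB (lexx _) lower) _.
rewrite -EFinB lee_fin sumrB sumr_const mulrBr.
have -> : #|msets|%:R^-1 * (T%:R *+ #|msets|) = T%:R :> R.
  by rewrite -[T%:R *+ _]mulr_natr mulrCA mulVf ?mulr1// gt_eqF.
have : T%:R * \big[Num.max/0]_(i < k) mu i <= T%:R by rewrite ler_piMr// bigmax_mu_le1.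
by lra.
Qed.

End SubsampledRegret.

Section PriorExpectation.
Variables (R : realType) (I : eqType) (Q : I -> probability R R).

Lemma iint_coord (w : R -> \bar R) c cs Y : measurable_fun setT w -> (forall x, (0 <= w x)%E) ->
  c \in cs -> uniq cs -> iint Q cs (fun Y => w (Y c)) Y = (\int[Q c]_x w x)%E.
Proof.
move=> mw w0 ccs ucs; rewrite (iint_inner _ _ (c := c))//; last first.
  by move=> d T p mp; apply: measurableT_comp.
rewrite (_ : (fun Z => _) = fun=> (\int[Q c]_x w x)%E) ?iint_cst//.
by apply/funext => Z; apply: eq_integral => y _; rewrite updE eqxx.
Qed.

(** Independence: each factor is integrated out in turn, the others being constant in its
    coordinate. *)
Lemma le_iint_prod (g : I -> R -> R) (e : I -> R) cs ds Y :
  (forall c, measurable_fun setT (g c)) -> (forall c x, 0 <= g c x) ->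
  (forall c, (\int[Q c]_x (g c x)%:E <= (e c)%:E)%E) ->
  uniq cs -> uniq ds -> {subset ds <= cs} ->
  (iint Q cs (fun Y => (\prod_(c <- ds) g c (Y c))%:E) Y <= (\prod_(c <- ds) e c)%:E)%E.
Proof.
move=> mg g0 ge ucs.
have mprod s : fammeas (fun Y => (\prod_(c <- s) g c (Y c))%:E).
  move=> d T p mp; apply: measurableT_comp => //.
  by apply: measurable_prod => c _; exact: measurableT_comp.
have p0 s Z : 0 <= \prod_(c <- s) g c (Z c) by apply: prodr_ge0.
elim: ds => [_ _|c ds IH /= /andP[cds uds] sub].
  by rewrite big_nil; under eq_fun do rewrite big_nil; rewrite iint_cst.
rewrite (iint_inner _ _ (c := c))//; last 2 first.
- by apply: sub; rewrite in_cons eqxx.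
- by move=> Z; rewrite lee_fin.
have e0 : 0 <= e c.
  by rewrite -lee_fin; apply: le_trans (ge c); apply: integral_ge0 => x _; rewrite lee_fin.
apply: (@le_trans _ _ (iint Q cs (fun Y => (e c * \prod_(c <- ds) g c (Y c))%:E) Y)).
  apply: le_iint => Z.
  have E y : (\prod_(j <- c :: ds) g j (upd Z c y j))%:E =
     ((\prod_(j <- ds) g j (Z j))%:E * (g c y)%:E)%E.
    rewrite big_cons updE eqxx mulrC EFinM; congr (_%:E * _)%E.
    apply: eq_big_seq => j jds; rewrite updE; case: eqP => // jc.
    by move: cds; rewrite -jc jds.
  under eq_integral do rewrite E.
  rewrite ge0_integralZl_EFin//; last 2 first.
  - by move=> y _; rewrite lee_fin.
  - by apply: measurableT_comp => //; exact: mg.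
  rewrite [X in (_ <= X%:E)%E]mulrC EFinM; apply: lee_wpmul2l => //.
  by rewrite lee_fin.
  exact: ge.
rewrite big_cons; apply: le_iint_scale => //.
by apply: IH => // j jds; apply: sub; rewrite in_cons jds orbT.
Qed.

End PriorExpectation.

(** * Prior expectation of the inverse gap *)

Section DyadicPeeling.
Variable R : realType.

(* Abel summation over dyadic shells loses less than summing shell by shell. *)
Lemma inv_le_dyadic (r : R) J : 2 ^- J < r ->
  r^-1 <= 1 + \sum_(j < J) 2 ^+ j * (r <= 2 ^- j)%R%:R.
Proof.
elim: J => [|J IH] h.
  by rewrite big_ord0 addr0; rewrite expr0 invr1 in h; rewrite invf_le1 ?ltW//; lra.
have r0 : 0 < r by apply: le_lt_trans h; rewrite invr_ge0 exprn_ge0.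
have [hJ|hJ] := ltP (2 ^- J) r.
  by apply: le_trans (IH hJ) _; rewrite lerD2l big_ord_recr /= lerDl mulr_ge0// exprn_ge0.
have -> : \sum_(j < J.+1) 2 ^+ j * (r <= 2 ^- j)%R%:R = \sum_(j < J.+1) (2 : R) ^+ j.
  apply: eq_bigr => j _; suff -> : r <= 2 ^- j by rewrite mulr1.
  apply: le_trans hJ _; rewrite lef_pV2 ?posrE ?exprn_gt0//.
  by rewrite ler_eXn2l ?ltr1n// -ltnS.
have -> : 1 + \sum_(j < J.+1) (2 : R) ^+ j = 2 ^+ J.+1.
  by have := subrX1 (2 : R) J.+1; lra.
by rewrite -[leRHS]invrK lef_pV2 ?posrE ?invr_gt0 ?exprn_gt0// ltW.
Qed.

Definition dyadic_tail (j : nat) : set R := `[(1 - 2 ^- j)%R, +oo[%classic.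

(** A majorant of the cost of an arm of mean [x], built from tail indicators so that its expectation
    only involves the prior tails bounded by regularity. *)
Definition peel (a : R) (J : nat) (x : R) : R :=
  1 + a + \sum_(j < J) a * 2 ^+ j * \1_(dyadic_tail j) x.

Lemma peel_ge0 a J x : 0 <= a -> 0 <= peel a J x.
Proof.
move=> a0; apply: addr_ge0; first by rewrite addr_ge0.
by apply: sumr_ge0 => j _; rewrite !mulr_ge0// exprn_ge0.
Qed.

Lemma measurable_peel a J : measurable_fun setT (peel a J).
Proof.
apply: measurable_funD; first exact: measurable_cst.
apply: measurable_sum => j; apply: measurable_funM; first exact: measurable_cst.
by apply: measurable_indic; exact: measurable_itv.
Qed.

Lemma le_peel (a theta x : R) J : 0 <= a -> 2 ^- J <= theta ->
  (theta < 1 - x)%R%:R * (1 + a / (1 - x)) <= peel a J x.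
Proof.
move=> a0 hJ; case: ltP => hx; last by rewrite mul0r peel_ge0.
rewrite mul1r /peel -addrA lerD2l.
have := @inv_le_dyadic (1 - x) J (le_lt_trans hJ hx).
move=> /(ler_wpM2l a0) /le_trans; apply.
rewrite mulrDr mulr1 lerD2l mulr_sumr; apply: ler_sum => j _.
rewrite mulrA ler_wpM2l ?mulr_ge0 ?exprn_ge0// indicE.
case: (leP (1 - x)) => // h; rewrite mem_set// /dyadic_tail /= in_itv /= andbT; lra.
Qed.

(** In each shell the weight 2^j cancels the tail bound C0 / 2^j, so the [J] shells contribute
    [a * C0] each. *)
Lemma integral_peel (Gamma : probability R R) (C0 a : R) (J : nat) : 0 <= a ->
  (forall eps : R, 0 < eps <= 1 -> (Gamma `[(1 - eps)%R, +oo[%classic <= (C0 * eps)%:E)%E) ->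
  (\int[Gamma]_x (peel a J x)%:E <= (1 + a * (1 + C0 * J%:R))%:E)%E.
Proof.
move=> a0 hG; pose A := dyadic_tail.
have mA j : measurable (A j) by exact: measurable_itv.
rewrite (_ : (fun x => _) = fun x => ((1 + a)%:E +
    \sum_(j < J) (a * 2 ^+ j)%:E * (\1_(A j) x)%:E)%E); last first.
  apply/funext => x; rewrite /peel EFinD -sumEFin; congr (_ + _)%E.
have t0 j x : (0 <= (a * 2 ^+ j)%:E * (\1_(A j) x)%:E)%E.
  by rewrite mule_ge0// lee_fin// mulr_ge0// exprn_ge0.
have mt j : measurable_fun setT (fun x => (a * 2 ^+ j)%:E * (\1_(A j) x)%:E)%E.
  apply: emeasurable_funM; first exact: measurable_cst.
  by apply: measurableT_comp => //; exact: measurable_indic.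
have ms : measurable_fun setT (fun x => \sum_(j < J) ((a * 2 ^+ j)%:E * (\1_(A j) x)%:E))%E.
  exact: emeasurable_sum.
have s0 x : (0 <= \sum_(j < J) ((a * 2 ^+ j)%:E * (\1_(A j) x)%:E))%E by exact: sume_ge0.
have a1 : (0 <= (1 + a)%:E)%E by rewrite lee_fin; lra.
rewrite ge0_integralD// integral_prob_cst ge0_integral_sum//.
apply: (@le_trans _ _ ((1 + a)%:E + \sum_(j < J) (a * C0)%:E)%E).
  apply: leeD => //; apply: lee_sum => j _.
  have i0 x : (0 <= (\1_(A j) x)%:E :> \bar R)%E by rewrite lee_fin.
  have mi : measurable_fun setT (fun x => (\1_(A j) x)%:E : \bar R).
    by apply: measurableT_comp => //; exact: measurable_indic.
  have aj : 0 <= a * 2 ^+ j by rewrite mulr_ge0// exprn_ge0.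
  rewrite ge0_integralZl_EFin//.
  rewrite integral_indic// setIT.
  have e1 : 0 < (2 : R) ^- j <= 1.
    rewrite invr_gt0 exprn_gt0//= invf_le1 ?exprn_gt0// exprn_ege1// ler1n//.
  apply: (@le_trans _ _ ((a * 2 ^+ j)%:E * (C0 * 2 ^- j)%:E)%E).
    by apply: lee_wpmul2l; [rewrite lee_fin mulr_ge0// exprn_ge0|exact: hG].
  rewrite -EFinM lee_fin le_eqVlt; apply/orP; left; apply/eqP; field.
  by rewrite expf_neq0.
rewrite sumEFin -EFinD lee_fin sumr_const card_ord -mulr_natr; lra.
Qed.

End DyadicPeeling.

(** * Bayesian regret for a free threshold *)

Section BayesRegret.
Variables (R : realType) (k T m : nat) (Gamma : probability R R) (P : R -> probability R R).
Hypothesis HGsupp : Gamma `[0, 1]%classic = 1%E.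

(* Charging [+oo] outside the unit cube, a null set, makes a bound on the cube
   global, so the regret itself need not be measurable in the means. *)
Lemma le_bayes_regret (F : ('I_k -> R) -> R) :
  (forall mu, (forall i, 0 <= mu i <= 1) -> (ssucb_regret P m T mu <= (F mu)%:E)%E) ->
  fammeas (fun mu => (F mu)%:E) -> (forall mu, 0 <= F mu) ->
  (ssucb_bayes_regret k Gamma P m T <=
   iint (fun _ : 'I_k => Gamma) (enum 'I_k) (fun mu => (F mu)%:E) (fun=> 0%R))%E.
Proof.
move=> hF mF F0.
(* By the convention that infinity times 0 is 0, [w] vanishes on the unit interval and has integral
   0. *)
pose w (x : R) : \bar R := (+oo * (\1_(~` `[0%R, 1%R]%classic) x)%:E)%E.
have mind : measurable_fun setT (fun x : R => (\1_(~` `[0%R, 1%R]%classic) x)%:E : \bar R).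
  apply: measurableT_comp => //; apply: measurable_indic.
  by apply: measurableC; exact: measurable_itv.
have ind0 (x : R) : (0 <= (\1_(~` `[0%R, 1%R]%classic) x)%:E :> \bar R)%E by rewrite lee_fin.
have w0 x : (0 <= w x)%E by rewrite /w mule_ge0.
have mw : measurable_fun setT w.
  by apply: emeasurable_funM => //; exact: measurable_cst.
have iw : (\int[Gamma]_x w x = 0)%E.
  rewrite /w ge0_integralZl// integral_indic//; last first.
    by apply: measurableC; exact: measurable_itv.
  rewrite setIT; have := @probability_setC _ _ _ Gamma `[0, 1]%classic (measurable_itv _).
  by rewrite HGsupp subee// => /= ->; rewrite mule0.
have mwi i : fammeas (fun mu : 'I_k -> R => w (mu i)).
  by move=> d V p mp; exact: (measurableT_comp mw (mp i)).
apply: (@le_trans _ _ (iint (fun _ : 'I_k => Gamma) (enum 'I_k)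
   (fun mu => (F mu)%:E + \sum_(i <- enum 'I_k) w (mu i))%E (fun=> 0%R))).
  apply: le_iint => mu.
  have [mu01|] := boolP [forall i, (0 <= mu i <= 1)].
    apply: (le_trans (hF mu (forallP mu01))).
    by rewrite leeDl// sume_ge0.
  rewrite negb_forall => /existsP[i hi].
  suff -> : (\sum_(i <- enum 'I_k) w (mu i) = +oo)%E by rewrite addey// leey.
  have wi : w (mu i) = +oo%E.
    rewrite /w indicE mem_set ?mule1//= => h; case/negP: hi.
    by move: h; rewrite /= in_itv.
  rewrite big_enum (bigD1 i)//= wi addye// gt_eqF//.
  by rewrite (lt_le_trans (ltNyr 0))// sume_ge0.
have Fe mu : (0 <= (F mu)%:E)%E by rewrite lee_fin.
rewrite iintD//; last 2 first.
- exact: fammeas_sum.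
- by move=> mu; apply: sume_ge0.
rewrite iint_sum// big1 ?adde0// => i _.
by rewrite (iint_coord _ _ (w := w)) ?mem_enum ?enum_uniq.
Qed.

Lemma bayes_regret_leT : (ssucb_bayes_regret k Gamma P m T <= T%:R%:E)%E.
Proof.
apply: (le_trans (le_bayes_regret (F := fun=> T%:R) _ _ _)).
- by move=> mu mu01; exact: ssucb_regret_leT.
- by move=> *; exact: measurable_cst.
- by [].
- by rewrite iint_cst.
Qed.

Hypothesis Psg : forall mu : R, 0 <= mu <= 1 -> forall s : R,
  (\int[P mu]_x (expR (s * (x - mu)))%:E <= (expR (s ^+ 2 / 2))%:E)%E.
Hypotheses (m0 : (0 < m)%N) (mk : (m <= k)%N).

(** The means being i.i.d., the expected bound depends on the sampled subset only through its size
    [m], so the average over subsets collapses. *)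
Lemma bayes_regret_le (c0 C0 theta : R) (J : nat)
  (a := (8 * ln (flog R T) + 128) * (100 / 81)) :
  0 < theta -> 2 ^- J <= 10 * theta ->
  ((c0 * theta)%:E <= Gamma `[(1 - theta)%R, +oo[%classic)%E ->
  (forall eps : R, 0 < eps <= 1 -> (Gamma `[(1 - eps)%R, +oo[%classic <= (C0 * eps)%:E)%E) ->
  (ssucb_bayes_regret k Gamma P m T <= (T%:R * (1 - c0 * theta) ^+ m +
     10 * theta * T%:R + m%:R * (1 + a * (1 + C0 * J%:R)))%:E)%E.
Proof.
move=> th0 hJ hc0 hC0.
have a0 : 0 <= a.
  have : 0 <= ln (flog R T) by rewrite ln_ge0// flog_ge1.
  by rewrite /a; lra.
have N0 := card_msets_gt0 R mk.
pose bad (x : R) : R := \1_(`]-oo, (1 - theta)%R[%classic) x.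
have mbad : measurable_fun setT bad by apply: measurable_indic; exact: measurable_itv.
have ibad : (\int[Gamma]_x (bad x)%:E <= (1 - c0 * theta)%:E)%E.
  rewrite integral_indic// setIT.
  have -> : `]-oo, (1 - theta)%R[%classic = ~` `[(1 - theta)%R, +oo[%classic :> set R.
    by rewrite setCitvr.
  have := @probability_setC _ _ _ Gamma _ (measurable_itv `[(1 - theta)%R, +oo[).
  by move=> /= ->; rewrite EFinB; apply: leeB.
pose H (S : {set 'I_k}) (mu : 'I_k -> R) : R := T%:R * \prod_(i <- enum S) bad (mu i) +
  10 * theta * T%:R + \sum_(i <- enum S) peel a J (mu i).
have mp (S : {set 'I_k}) : fammeas (fun mu : 'I_k -> R => (\prod_(i <- enum S) bad (mu i))%:E).
  move=> d V p hp; apply: measurableT_comp => //.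
  by apply: measurable_prod => i _; exact: (measurableT_comp mbad (hp i)).
have mpeel (i : 'I_k) : fammeas (fun mu : 'I_k -> R => (peel a J (mu i))%:E).
  move=> d V p hp; apply: measurableT_comp => //.
  exact: (measurableT_comp (measurable_peel a J) (hp i)).
have mcst : fammeas (fun mu : 'I_k -> R => (10 * theta * T%:R)%:E).
  by move=> *; exact: measurable_cst.
have peel0 x : 0 <= peel a J x by exact: peel_ge0.
have prod0 (S : {set 'I_k}) (mu : 'I_k -> R) : 0 <= \prod_(i <- enum S) bad (mu i) by exact: prodr_ge0.
have t0 : 0 <= 10 * theta * T%:R by rewrite !mulr_ge0// ltW.
have HE S : (fun mu => (H S mu)%:E) = fun mu => (((T%:R * \prod_(i <- enum S) bad (mu i))%:E +
  (10 * theta * T%:R)%:E) + (\sum_(i <- enum S) peel a J (mu i))%:E)%E.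
  by apply/funext => mu; rewrite !EFinD.
have m1 (S : {set 'I_k}) : fammeas (fun mu : 'I_k -> R => (T%:R * \prod_(i <- enum S) bad (mu i))%:E).
  exact: (fammeas_scale _ (mp S)).
have m2 S := fammeasD (m1 S) mcst.
have m3 (S : {set 'I_k}) : fammeas (fun mu : 'I_k -> R => (\sum_(i <- enum S) peel a J (mu i))%:E).
  exact: (fammeas_rsum (enum S) mpeel).
have mH S : fammeas (fun mu => (H S mu)%:E) by rewrite HE; exact: (fammeasD (m2 S) (m3 S)).
have H0 S mu : 0 <= H S mu.
  by rewrite addr_ge0 ?sumr_ge0// addr_ge0// mulr_ge0.
pose F mu := #|msets k m|%:R^-1 * \sum_(S <- enum (msets k m)) H S mu.
apply: (le_trans (le_bayes_regret (F := F) _ _ _)).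
- move=> mu mu01.
  apply: (le_trans (ssucb_regret_le T mu01 (fun i => Psg (mu01 i)) m0 mk th0)).
  rewrite lee_fin /F ler_pM2l ?invr_gt0// big_enum; apply: ler_sum => S _.
  rewrite /subset_regret_bound /H !big_enum; apply: lerD.
    rewrite lerD2r ler_wpM2l// le_eqVlt; apply/orP; left; apply/eqP.
    apply: eq_bigr => i _; rewrite /bad indicE; congr ((nat_of_bool _)%:R).
    by apply/idP/idP => [h|/set_mem]; [rewrite mem_set//= in_itv|rewrite /= in_itv].
  by apply: ler_sum => i _; exact: le_peel.
- by apply: fammeas_scale; exact: fammeas_rsum.
- by move=> mu; rewrite mulr_ge0 ?invr_ge0 ?sumr_ge0// ltW.
set B := _ + m%:R * _.
apply: (@le_trans _ _ (#|msets k m|%:R^-1 * \sum_(S <- enum (msets k m)) B)%:E); last first.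
  rewrite lee_fin big_enum sumr_const -[B *+ _]mulr_natr mulrCA mulVf ?mulr1//.
  by rewrite gt_eqF.
apply: le_iint_scale.
- exact: fammeas_rsum.
- by move=> mu; rewrite sumr_ge0.
- by rewrite invr_ge0 ltW.
apply: le_iint_sum => // S; rewrite mem_enum finset.inE => /eqP Sm.
rewrite HE.
have p1 mu : (0 <= (T%:R * \prod_(i <- enum S) bad (mu i))%:E)%E by rewrite lee_fin mulr_ge0.
have p3 mu : (0 <= (\sum_(i <- enum S) peel a J (mu i))%:E)%E by rewrite lee_fin sumr_ge0.
have t1 : (0 <= (10 * theta * T%:R)%:E)%E by rewrite lee_fin.
rewrite iintD//; last by move=> mu; rewrite adde_ge0.
rewrite iintD// iint_cst /B !EFinD; apply: leeD; first apply: leeD => //.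
  apply: le_iint_scale => //.
  have := le_iint_prod (Q := fun _ : 'I_k => Gamma) (g := fun=> bad)
    (e := fun=> 1 - c0 * theta) (fun=> 0) (fun=> mbad) (fun _ x => _) (fun=> ibad)
    (enum_uniq 'I_k) (enum_uniq S).
  rewrite [X in (_ -> _ -> (_ <= X%:E)%E)]big_enum prodr_const Sm; apply => //.
  by move=> i _; rewrite mem_enum.
apply: (@le_trans _ _ (\sum_(i <- enum S) (1 + a * (1 + C0 * J%:R)))%:E).
  apply: le_iint_sum => // i iS.
  rewrite (iint_coord _ _ (w := fun x => (peel a J x)%:E)) ?mem_enum ?enum_uniq//.
    exact: integral_peel.
  by apply: measurableT_comp => //; exact: measurable_peel.
by rewrite lee_fin big_enum sumr_const Sm -[leLHS]mulr_natl.
Qed.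

End BayesRegret.

(** * Comparison of the constants *)

Section LogEstimates.
Variable R : realType.

Lemma ln3_ge1 : 1 <= ln (3 : R).
Proof.
have := ln_succ_sub R (ltn0Sn 1); have := ln2_ge23 R; lra.
Qed.

(** As ln 3 >= 1, powers of 3 serve as rational substitutes for powers of e. *)
Lemma ln_ge_pow3 (x : R) n : 3 ^+ n <= x -> n%:R <= ln x.
Proof.
move=> h.
have p : 0 < (3 : R) ^+ n by rewrite exprn_gt0.
apply: (@le_trans _ _ (ln (3 ^+ n))); last by rewrite ler_ln ?posrE// (lt_le_trans p).
rewrite lnXn// -[leRHS]mulr_natl ler_peMr//; exact: ln3_ge1.
Qed.

(** From ln T <= T - 1 one gets f(T) <= T^3. *)
Lemma ln_flog_le (T : nat) : (0 < T)%N -> ln (flog R T) <= 3 * T%:R.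
Proof.
move=> T0; have T1 : 1 <= (T%:R : R) by rewrite ler1n.
have l0 : 0 <= ln (T%:R : R) by rewrite ln_ge0.
have lT : ln (T%:R : R) <= T%:R - 1.
  by have := @le_ln1Dx R (T%:R - 1); rewrite [1 + _]addrC subrK; apply; lra.
have fT : flog R T <= T%:R ^+ 3.
  rewrite /flog; set l := ln _ in l0 lT *; set t : R := T%:R in T1 lT *.
  have : l ^+ 2 <= (t - 1) ^+ 2 by rewrite ler_pXn2r ?nnegrE//; lra.
  move=> h; have : t * l ^+ 2 <= t * (t - 1) ^+ 2 by rewrite ler_pM2l//; lra.
  by nra.
apply: (@le_trans _ _ (ln (T%:R ^+ 3))).
  by rewrite ler_ln ?posrE ?flog_gt0// exprn_gt0//; lra.
rewrite lnXn; last by lra.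
by rewrite -[leLHS]mulr_natl ler_pM2l//; lra.
Qed.

End LogEstimates.

Section FinalComparison.
Variables (R : realType) (T : nat) (c0 C0 : R).
Hypotheses (HT : (2 <= T)%N) (c00 : 0 < c0) (c01 : c0 <= 1) (C01 : 1 <= C0).
Local Notation s := (Num.sqrt (T%:R : R)).
Local Notation l := (ln (T%:R : R)).
Local Notation L := (ln (flog R T)).

Let T2 : 2 <= (T%:R : R). Proof. by rewrite ler_nat. Qed.
Let s0 : 0 < s. Proof. by rewrite sqrtr_gt0; have := T2; lra. Qed.
Let ss : s * s = T%:R. Proof. by rewrite -expr2 sqr_sqrtr//; have := T2; lra. Qed.
Let l0 : 0 < l. Proof. by rewrite ln_gt0//; have := T2; lra. Qed.
Let L0 : 0 <= L. Proof. by rewrite ln_ge0// flog_ge1. Qed.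

Definition final_bound : R := 2 + s * (l / c0 + C0 * l ^+ 2 / c0 ^+ 2
  + C0 * (20 + 36 * L) * (5 + ln (s * c0) - ln l)).

Let C0p : 0 <= C0. Proof. exact: le_trans ler01 C01. Qed.

Let theta := l / (c0 * s).

Let theta0 : 0 < theta. Proof. by rewrite divr_gt0// mulr_gt0. Qed.

(** In terms of [theta], the three summands become directly comparable with those of
    [bayes_regret_le]. *)
Lemma final_boundE : final_bound = 2 + theta * T%:R + s * (C0 * (theta ^+ 2 * T%:R
  + (20 + 36 * L) * (5 - ln theta))).
Proof.
have -> : ln theta = ln l - ln (s * c0) by rewrite /theta [c0 * s]mulrC ln_div ?posrE// mulr_gt0.
have := l0; have := s0; have := ss; rewrite /final_bound /theta.
move: (ln (s * c0)) (ln l) L l s => a b LL ll q <- q0 ll0; field.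
by rewrite !gt_eqF.
Qed.

(** The summand [theta * T%:R] already suffices; the remaining ones must be shown nonnegative
    together, since [5 - ln theta] may be negative. In that case [theta] exceeds exp 5 and the
    square term compensates. *)
Lemma final_bound_large_theta : 1 <= theta -> T%:R <= final_bound.
Proof.
move=> th1; rewrite final_boundE.
have tT : T%:R <= theta * T%:R by rewrite ler_peMl//; have := T2; lra.
suff : 0 <= theta ^+ 2 * T%:R + (20 + 36 * L) * (5 - ln theta).
  move=> h; have : 0 <= s * (C0 * (theta ^+ 2 * T%:R + (20 + 36 * L) * (5 - ln theta))).
    apply: mulr_ge0; first exact: ltW s0.
    exact: mulr_ge0.
  by lra.
have [h5|h5] := leP (ln theta) 5.
  apply: addr_ge0; first by rewrite mulr_ge0 ?sqr_ge0.
  by rewrite mulr_ge0; have := L0; lra.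
have L3 : L <= 3 * T%:R by apply: ln_flog_le; exact: leq_trans HT.
have e5 : 32 <= expR (5 : R).
  have -> : expR 5 = expR 1 ^+ 5 :> R by rewrite -expRM_natl mulr1.
  have h2 : 2 <= expR 1 :> R by have := expR_ge1Dx (1 : R); lra.
  apply: (@le_trans _ _ (2 ^+ 5)); first by lra.
  by apply: lerXn2r; rewrite ?nnegrE ?expR_ge0.
have ey : expR 5 < theta by rewrite -[X in _ < X](lnK theta0) ltr_expR.
have e0 : 0 < expR (5 : R) by exact: expR_gt0.
have lny : ln theta - 5 <= theta / 32.
  have -> : ln theta - 5 = ln (theta / expR 5) by rewrite ln_div ?posrE// expRK.
  apply: (@le_trans _ _ (theta / expR 5 - 1)).
    have := @le_ln1Dx R (theta / expR 5 - 1); rewrite [1 + _]addrC subrK; apply.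
    have p : 0 < theta / expR 5 by rewrite divr_gt0.
    lra.
  have : theta / expR 5 <= theta / 32.
    by rewrite ler_pM2l// lef_pV2 ?posrE//; lra.
  by lra.
have := T2; have := L0; set y := theta in h5 ey lny *; set lg := ln y in h5 lny *; set t : R := T%:R in L3 *.
set LL := L in L3 * => LL0 t2.
(* Here 20 + 108 t <= 118 t because t >= 2; then 118 / 32 is below y, which is at least 32. *)
have h1 : (20 + 36 * LL) * (lg - 5) <= (118 * t) * (y / 32).
  by apply: ler_pM => //; lra.
have h2 : 118 * t * (y / 32) <= t * y ^+ 2.
  have y32 : 32 <= y by exact: le_trans e5 (ltW ey).
  have y0 : 0 <= y by exact: ltW theta0.
  have ty : 0 <= t * y by apply: mulr_ge0 => //; lra.
  have : 0 <= t * y * (y - 32) by apply: mulr_ge0 => //; rewrite subr_ge0.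
  by nra.
by lra.
Qed.

(* Here the last summand of the bound alone is at least [T]. *)
Lemma final_bound_small_T : theta < 1 -> s <= 100 + 180 * L -> T%:R <= final_bound.
Proof.
move=> th1 sL; rewrite final_boundE.
have lt : ln theta <= 0 by rewrite ln_le0 ?ltW.
have tT : 0 <= theta * T%:R by rewrite mulr_ge0// ltW.
have tT2 : 0 <= theta ^+ 2 * T%:R by rewrite mulr_ge0// sqr_ge0.
have h : s <= C0 * (theta ^+ 2 * T%:R + (20 + 36 * L) * (5 - ln theta)).
  have k0 : 0 <= (20 + 36 * L) * (- ln theta) by rewrite mulr_ge0; have := L0; lra.
  have k1 : s <= theta ^+ 2 * T%:R + (20 + 36 * L) * (5 - ln theta) by lra.
  by apply: le_trans k1 _; rewrite ler_peMl//; have := s0; lra.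
by have := ler_wpM2l (ltW s0) h; rewrite ss; lra.
Qed.

(** The lower bound on [s] forces [T], hence [L], to be large, and a large [L] absorbs the crude
    constants of the pull-count estimate. *)
Lemma final_bound_main (m J : nat) : theta < 1 -> 100 + 180 * L < s ->
  m%:R <= s + 1 -> J%:R <= 3 / 2 * (- ln theta) + 1 ->
  1 + 10 * theta * T%:R +
    m%:R * (1 + (8 * L + 128) * (100 / 81) * (1 + C0 * J%:R)) <= final_bound.
Proof.
move=> th1 sL hm hJ; rewrite final_boundE.
have s100 : 100 < s by have := L0; lra.
have lL : 1 <= l -> L >= l.
  move=> l1; rewrite ler_ln ?posrE ?flog_gt0//; last by have := T2; lra.
  rewrite /flog; have : 1 <= l ^+ 2 by rewrite exprn_ege1.
  have := T2; set t : R := T%:R; move=> t2 h.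
  have : t * 1 <= t * l ^+ 2 by rewrite ler_pM2l//; lra.
  by lra.
have sT x : 0 <= x -> x <= s -> x ^+ 2 <= T%:R.
  by move=> x0 xs; rewrite -ss -expr2 ler_pXn2r ?nnegrE// ltW.
(* Bootstrapping: s > 100 gives T >= 3^8, hence L >= 8, hence s > 1540 and T >= 3^13. The factor
   ln^2 T in f(T) then lifts 13 to 17, as ln 9 >= 2. *)
have l8 : 8 <= l by apply: (ln_ge_pow3 (n := 8)); apply: le_trans (sT 100 _ _); lra.
have L8 : 8 <= L by apply: le_trans (lL _); lra.
have l13 : 13 <= l by apply: (ln_ge_pow3 (n := 13)); apply: le_trans (sT 1540 _ _); lra.
have L17 : 17 <= L.
  apply: (@le_trans _ _ (ln (T%:R * l ^+ 2))).
    rewrite lnM ?posrE ?exprn_gt0//; last by have := T2; lra.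
    rewrite lnXn// mulr2n.
    have : 2 <= ln l by apply: (ln_ge_pow3 (n := 2)); lra.
    by lra.
  have p : 0 < T%:R * l ^+ 2 by rewrite mulr_gt0 ?exprn_gt0//; have := T2; lra.
  by rewrite ler_ln ?posrE ?flog_gt0// /flog; lra.
have lt : ln theta <= 0 by rewrite ln_le0 ?ltW.
(* One of the ten [theta * T%:R] occurs in the bound itself; the other nine fit in the square term,
   since [s * theta = l / c0] is at least 13. *)
have main1 : 9 * (theta * T%:R) <= s * (C0 * (theta ^+ 2 * T%:R)).
  have -> : s * (C0 * (theta ^+ 2 * T%:R)) = (C0 * (s * theta)) * (theta * T%:R) by ring.
  apply: ler_wpM2r; first by apply: mulr_ge0 => //; exact: ltW theta0.
  have c1 : c0 <= 1 by exact: c01.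
  have -> : s * theta = l / c0 by rewrite /theta; field; rewrite !gt_eqF.
  have h : 9 <= l / c0 by rewrite ler_pdivlMr//; lra.
  by apply: le_trans h _; rewrite ler_peMl//; rewrite divr_ge0// ltW.
have main2 : m%:R * (1 + (8 * L + 128) * (100 / 81) * (1 + C0 * J%:R)) <=
   s * (C0 * ((20 + 36 * L) * (5 - ln theta))).
  set Lam := - ln theta in hJ *.
  have Lam0 : 0 <= Lam by rewrite /Lam; lra.
  have CJ : C0 * J%:R <= C0 * (3 / 2 * Lam + 1) by apply: ler_wpM2l.
  have a0 : 0 <= (8 * L + 128) * (100 / 81) by lra.
  set a := _ * (100 / 81) in a0 *.
  have h1 : 1 + a * (1 + C0 * J%:R) <= C0 * (1 + a * (2 + 3 / 2 * Lam)).
    have h2 : a * (C0 * J%:R) <= a * (C0 * (3 / 2 * Lam + 1)) by rewrite ler_wpM2l.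
    have h3 : a <= a * C0 by rewrite ler_peMr.
    by have := C01; lra.
  have m1 : m%:R <= 101 / 100 * s by lra.
  apply: (@le_trans _ _ ((101 / 100 * s) * (C0 * (1 + a * (2 + 3 / 2 * Lam))))).
    apply: ler_pM => //; rewrite addr_ge0// mulr_ge0// addr_ge0// mulr_ge0//; have := C01; lra.
  have -> : 101 / 100 * s * (C0 * (1 + a * (2 + 3 / 2 * Lam))) =
     s * (C0 * (101 / 100 * (1 + a * (2 + 3 / 2 * Lam)))) by ring.
  rewrite ler_pM2l// ler_pM2l; last by have := C01; lra.
  (* The coefficient of [Lam] is about 15 L + 239 on the left, against 36 L + 20 on the right. *)
  have : 0 <= (L - 17) * Lam by rewrite mulr_ge0//; lra.
  by rewrite /a; nra.
have -> : s * (C0 * (theta ^+ 2 * T%:R + (20 + 36 * L) * (5 - ln theta))) =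
   s * (C0 * (theta ^+ 2 * T%:R)) + s * (C0 * ((20 + 36 * L) * (5 - ln theta))) by ring.
by lra.
Qed.

End FinalComparison.

Theorem theorem3 (R : realType) (k T m : nat)
  (Gamma : probability R R) (P : R -> probability R R) (c0 C0 : R)
  (* prior on [0,1] with a density w.r.t. Lebesgue measure *)
  (HGsupp : Gamma `[0, 1]%classic = 1%E)
  (HGdens : exists g : R -> R, measurable_fun setT g /\ (forall x, 0 <= g x) /\
     forall A, measurable A ->
       Gamma A = (\int[lebesgue_measure]_(x in A) (g x)%:E)%E)
  (* 1-regularity *)
  (Hc0 : 0 < c0) (Hc0C0 : c0 < C0)
  (Hreg : forall eps : R, 0 < eps <= 1 ->
     ((c0 * eps)%:E <= Gamma `](1 - eps)%R, +oo[%classic)%E /\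
     (Gamma `](1 - eps)%R, +oo[%classic <= Gamma `[(1 - eps)%R, +oo[%classic)%E /\
     (Gamma `[(1 - eps)%R, +oo[%classic <= (C0 * eps)%:E)%E)
  (* the reward family P_mu, mu in [0,1]: measurable in mu, mean mu,
     1-subgaussian *)
  (HPmeas : forall B, measurable B -> measurable_fun [set: R] (P ^~ B))
  (HPmean : forall mu : R, 0 <= mu <= 1 -> (\int[P mu]_x x%:E = mu%:E)%E)
  (HPsg : forall mu : R, 0 <= mu <= 1 -> forall s : R,
     (\int[P mu]_x (expR (s * (x - mu)))%:E <= (expR (s ^+ 2 / 2))%:E)%E)
  (* horizon, subsample size m = ceil (sqrt T) <= k *)
  (HT : (2 <= T)%N)
  (Hm : m%:Z = Num.ceil (Num.sqrt (T%:R : R)))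
  (Hmk : (m <= k)%N) :
  (ssucb_bayes_regret k Gamma P m T <=
   (2 + Num.sqrt T%:R *
      (ln (T%:R : R) / c0 + C0 * (ln (T%:R : R)) ^+ 2 / c0 ^+ 2
       + C0 * (20 + 36 * ln (flog R T))
           * (5 + ln (Num.sqrt T%:R * c0) - ln (ln (T%:R : R)))))%:E)%E.
Proof.
have T2 : 2 <= (T%:R : R) by rewrite ler_nat.
have s0 : 0 < Num.sqrt (T%:R : R) by rewrite sqrtr_gt0; lra.
have l0 : 0 < ln (T%:R : R) by rewrite ln_gt0//; lra.
have one : 0 < (1 : R) <= 1 by rewrite ltr01 lexx.
(* Regularity at [eps = 1] compares [c0] and [C0] with the total mass of the prior. *)
have c01 : c0 <= 1.
  have [h _] := Hreg 1 one; rewrite -lee_fin -[c0]mulr1.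
  by apply: le_trans h (probability_le1 _ _); exact: measurable_itv.
have C01 : 1 <= C0.
  have [_ [_ h]] := Hreg 1 one; rewrite -lee_fin -[C0]mulr1 -HGsupp.
  apply: le_trans h; apply: le_measure; rewrite ?inE; try exact: measurable_itv.
  by rewrite subrr => x /=; rewrite !in_itv /= andbT => /andP[].
rewrite -/(final_bound T c0 C0).
set theta := ln (T%:R : R) / (c0 * Num.sqrt T%:R).
have th0 : 0 < theta by rewrite divr_gt0// mulr_gt0.
have trivial_bound := bayes_regret_leT k T m P HGsupp.
(* Regularity can be applied at [theta] only when [theta <= 1]; beyond that, the trivial regret
   bound [T] is used. *)
have [th1|th1] := leP 1 theta.
  by apply: le_trans trivial_bound _; rewrite lee_fin final_bound_large_theta.
have [sL|sL] := leP (Num.sqrt (T%:R : R)) (100 + 180 * ln (flog R T)).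
  by apply: le_trans trivial_bound _; rewrite lee_fin final_bound_small_T.
have /andP[m_lt m_ge] := ceil_itv (Num.sqrt (T%:R : R)).
rewrite -Hm in m_lt m_ge.
have mge : Num.sqrt T%:R <= (m%:R : R) by exact: m_ge.
have mlt : m%:R <= Num.sqrt T%:R + 1 :> R.
  by move: m_lt; rewrite intrB; change (m%:~R) with (m%:R : R); lra.
have m0 : (0 < m)%N by rewrite -(ltr0n R); exact: lt_le_trans mge.
(* The factor 3/2 is the inverse of the lower bound 2/3 for ln 2, so [J > y] ensures
   [2 ^- J <= theta]. *)
pose y := 3 / 2 * (- ln theta).
have lth : ln theta <= 0 by rewrite ln_le0 ?ltW.
have y0 : 0 <= y by rewrite /y; lra.
have [J yJ Jy] : exists2 J : nat, y < J%:R & J%:R <= y + 1.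
  have /andP[? ?] := truncn_itv y0; exists (Num.truncn y).+1 => //.
  by rewrite -natr1; lra.
have hJ : 2 ^- J <= theta.
  have p2 : 0 < (2 : R) ^+ J by rewrite exprn_gt0.
  rewrite -ler_ln ?posrE ?invr_gt0// lnV ?posrE// lnXn// -[ln 2 *+ J]mulr_natl.
  have : y * (2 / 3) <= J%:R * ln 2.
    by apply: ler_pM => //; [exact: ltW|exact: ln2_ge23].
  have -> : y * (2 / 3) = - ln theta by rewrite /y; field.
  by rewrite lerNl.
have thI : 0 < theta <= 1 by rewrite th0 ltW.
have [g1 [g2 _]] := Hreg theta thI.
have g3 := le_trans g1 g2.
have hJ10 : 2 ^- J <= 10 * theta by lra.
have hC eps : 0 < eps <= 1 -> (Gamma `[(1 - eps)%R, +oo[%classic <= (C0 * eps)%:E)%E.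
  by move=> he; have [_ [_]] := Hreg eps he.
apply: le_trans (bayes_regret_le T HGsupp HPsg m0 Hmk th0 hJ10 g3 hC) _.
rewrite lee_fin; apply: le_trans (final_bound_main HT Hc0 c01 C01 th1 sL mlt Jy).
rewrite -!addrA; apply: lerD => //.
have q1 : c0 * theta <= 1.
  by rewrite -lee_fin; apply: le_trans g3 (probability_le1 _ _); exact: measurable_itv.
(* By the choice of [theta], sqrt T times [c0 * theta] is ln T. As [m] is at least sqrt T, the event
   that all sampled arms are bad has probability at most 1/T and costs at most 1. *)
have h1 : (1 - c0 * theta) ^+ m <= expR (- (c0 * theta)) ^+ m.
  by apply: lerXn2r; rewrite ?nnegrE ?subr_ge0 ?expR_ge0//; have := expR_ge1Dx (- (c0 * theta)); lra.
have h2 : expR (- (c0 * theta)) ^+ m <= T%:R^-1.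
  rewrite -expRM_natl -[leRHS]lnK ?posrE ?invr_gt0; last by lra.
  rewrite ler_expR lnV ?posrE; last by lra.
  have -> : ln (T%:R : R) = Num.sqrt T%:R * (c0 * theta).
    by rewrite /theta; field; rewrite !gt_eqF.
  rewrite mulrN lerN2 ler_wpM2r// mulr_ge0 ?ltW//.
have tp : 0 < (T%:R : R) by lra.
have := ler_wpM2l (ltW tp) (le_trans h1 h2).
by rewrite mulfV// gt_eqF.
Qed.
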